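(* For every integer $k \ge 0$ and every integer $n \ge 3$, the $k$th moment of distance $I_{n,k}$ on the lens space $L(n;1)$ is $$I_{n,k} = \frac{1}{(k+1)(k+2)}\left[ \frac{4}{k+3}\left(\frac{\pi}{n}\right)^{k+2} {}_1F_2\!\left[1;\tfrac{k+4}{2},\tfrac{k+5}{2};-\tfrac{\pi^2}{n^2}\right] + \tan\frac{\pi}{n}\left( n\left(\frac{\pi}{2}\right)^{k+1} {}_1F_2\!\left[1;\tfrac{k+3}{2},\tfrac{k+4}{2};-\tfrac{\pi^2}{4}\right] - 2\left(\frac{\pi}{n}\right)^{k+1} {}_1F_2\!\left[1;\tfrac{k+3}{2},\tfrac{k+4}{2};-\tfrac{\pi^2}{n^2}\right]\right)\right].$$ Moreover, for $n=2$ and every integer $k\ge 0$, $I_{2,k}$ equals the limit of the right-hand side above (regarded as a function of a real variable $n$) as $n \to 2$.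
   Context: Let $\mathbb{S}^3=\{(\alpha,\beta)\in\mathbb{C}^2 : |\alpha|^2+|\beta|^2=1\}$ with its round metric of constant curvature $1$, and let $Z_n\subset\mathbb{C}$ be the cyclic group of $n$th roots of unity acting freely on $\mathbb{S}^3$ by $\omega\cdot(\alpha,\beta)=(\omega\alpha,\omega\beta)$. The lens space $L(n;1)=\mathbb{S}^3/Z_n$ carries the unique Riemannian metric making the quotient map $\mathbb{S}^3\to L(n;1)$ a Riemannian submersion (here a local isometry). The associated Riemannian distance is $$d([p],[q])=\min_{\omega\in Z_n} d_{\mathbb{S}^3}(\omega\cdot p,q),\qquad d_{\mathbb{S}^3}(p,q)=\arccos(p\cdot q),$$ where $p\cdot q$ is the real Euclidean inner product on $\mathbb{R}^4=\mathbb{C}^2$. The $k$th moment of distance is $I_{n,k}=\mathbb{E}[d(x,y)^k]$, where $x,y$ are independent random points of $L(n;1)$, each distributed according to normalized Riemannian volume (the push-forward of the uniform probability measure on $\mathbb{S}^3$). The hypergeometric function is ${}_1F_2[a;b_1,b_2;z]=\sum_{j=0}^\infty \frac{(a)_j}{(b_1)_j(b_2)_j}\frac{z^j}{j!}$, where $(a)_0=1$ and $(a)_j=a(a+1)\cdots(a+j-1)$ for $j\ge 1$. *)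

(* Defs.v *)
From HB Require Import structures.
From mathcomp Require Import all_boot all_order all_algebra.
From mathcomp Require Import generic_quotient complex.
From mathcomp Require Import all_classical all_reals all_analysis.
From mathcomp Require Import measurable_realfun.

Set Implicit Arguments.
Unset Strict Implicit.
Unset Printing Implicit Defensive.

Import Order.TTheory GRing.Theory Num.Theory.
Import numFieldNormedType.Exports.

Local Open Scope classical_set_scope.
Local Open Scope ring_scope.
Local Open Scope complex_scope.
Local Open Scope quotient_scope.

Section sphere3.
Context (R : realType).

Definition on_sphere3 (p : R[i] * R[i]) : bool :=
  `|p.1| ^+ 2 + `|p.2| ^+ 2 == 1.

Record sphere3 := Sphere3 {
  sphere3_val :> R[i] * R[i] ;
  sphere3P : on_sphere3 sphere3_val }.

HB.instance Definition _ := [isSub for sphere3_val].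
HB.instance Definition _ := [Choice of sphere3 by <:].

Lemma on_sphere3_10 : on_sphere3 (1, 0).
Proof. by rewrite /on_sphere3 /= normr1 normr0 expr1n expr0n addr0. Qed.

HB.instance Definition _ := isPointed.Build sphere3 (Sphere3 on_sphere3_10).

(* C^2 = R^4 is grouped as (Re alpha, Im alpha), (Re beta, Im beta). *)
Local Notation R4 := ((measurableTypeR R * measurableTypeR R) *
                      (measurableTypeR R * measurableTypeR R))%type.

Definition coords (p : R[i] * R[i]) : R4 :=
  ((complex.Re p.1, complex.Im p.1), (complex.Re p.2, complex.Im p.2)).

Definition dot4 (v w : R4) : R :=
  (v.1.1 * w.1.1 + v.1.2 * w.1.2) + (v.2.1 * w.2.1 + v.2.2 * w.2.2).

Definition dist_sphere3 (p q : R[i] * R[i]) : R :=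
  acos (dot4 (coords p) (coords q)).

Definition sphere3_coords (p : sphere3) : R4 := coords p.

(* The Borel sets of S^3 are the traces on S^3 of the Borel sets of R^4. *)
HB.instance Definition _ :=
  Measurable.copy sphere3 (g_sigma_algebra_preimageType sphere3_coords).

Definition lebesgue2 : set (measurableTypeR R * measurableTypeR R) -> \bar R :=
  (@lebesgue_measure R \x @lebesgue_measure R)%E.

HB.instance Definition _ := Measure.on lebesgue2.

Lemma lebesgue2_sigma_finite : sigma_finite setT lebesgue2.
Proof.
have /sigma_finiteP[F [TF ndF Foo]] := sigma_finiteT (@lebesgue_measure R).
exists (fun n => F n `*` F n).
  rewrite -setXTT TF predeqE => -[x y]; split.
    move=> [/= [n _ Fnx] [k _ Gky]]; exists (maxn n k) => //; split.
    - by move: x Fnx; exact/subsetPset/ndF/leq_maxl.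
    - by move: y Gky; exact/subsetPset/ndF/leq_maxr.
  by move=> [n _ []/= ? ?]; split; exists n.
move=> k; have [? ?] := Foo k.
split; first exact: measurableX.
by rewrite /lebesgue2 product_measure1E// lte_mul_pinfty// ge0_fin_numE.
Qed.

HB.instance Definition _ :=
  Measure_isSigmaFinite.Build _ _ _ lebesgue2 lebesgue2_sigma_finite.

Definition lebesgue4 : set R4 -> \bar R := (lebesgue2 \x lebesgue2)%E.

HB.instance Definition _ := Measure.on lebesgue4.

Definition ball4 : set R4 := [set v | dot4 v v <= 1].

Lemma measurable_dot4 : measurable_fun setT (fun v : R4 => dot4 v v).
Proof.
by do !apply: measurable_funD; apply: measurable_funM;
  apply: measurableT_comp => //; apply: measurableT_comp.
Qed.

Lemma measurable_ball4 : measurable ball4.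
Proof.
rewrite -[X in measurable X]setTI /ball4.
have -> : [set v : R4 | dot4 v v <= 1] =
          (fun v : R4 => dot4 v v) @^-1` `]-oo, 1].
  by apply/seteqP; split => v /=; rewrite in_itv.
exact: measurable_dot4.
Qed.

(* [v / |v|], in complex coordinates *)
Definition unit4 (v : R4) : R[i] * R[i] :=
  let r := Num.sqrt (dot4 v v) in
  ((v.1.1 / r) +i* (v.1.2 / r), (v.2.1 / r) +i* (v.2.2 / r)).

(* [unit4 v] is off the sphere only at the origin, which is sent to (1, 0). *)
Definition radial (v : R4) : sphere3 := insubd (point : sphere3) (unit4 v).

Lemma on_sphere3E (p : R[i] * R[i]) :
  on_sphere3 p = (dot4 (coords p) (coords p) == 1).
Proof.
by rewrite /on_sphere3 -!add_Re2_Im2 -rmorphD /= (inj_eq (@complexI R) _ 1).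
Qed.

Lemma measurable_unit4 : measurable_fun setT (fun v : R4 => coords (unit4 v)).
Proof.
have mr : measurable_fun setT (fun v : R4 => (Num.sqrt (dot4 v v))^-1).
  have -> : (fun v : R4 => (Num.sqrt (dot4 v v))^-1) =
            (fun v : R4 => (dot4 v v `^ 2^-1) `^ (-1)).
    apply/funext => v; rewrite powR_inv1 ?powR_ge0// powR12_sqrt//.
    by rewrite /dot4 -!expr2 !addr_ge0// sqr_ge0.
  exact: (measurableT_comp (measurable_powR (-1))
    (measurableT_comp (measurable_powR 2^-1) measurable_dot4)).
by do 2?apply: measurable_fun_pair; apply: measurable_funM => //;
  apply: measurableT_comp => //; apply: measurableT_comp.
Qed.

Lemma measurable_radial : measurable_fun [set: R4] radial.
Proof.
move=> _ _ [B mB <-]; rewrite !setTI.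
suff mc : measurable_fun setT (fun v : R4 => sphere3_coords (radial v)).
  by have := mc measurableT B mB; rewrite setTI.
have -> : (fun v : R4 => sphere3_coords (radial v)) =
    (fun v => if dot4 (coords (unit4 v)) (coords (unit4 v)) == 1
              then coords (unit4 v) else sphere3_coords point).
  apply/funext => v; rewrite /sphere3_coords /radial val_insubd on_sphere3E.
  by case: ifP.
apply: measurable_fun_ifT => //; last exact: measurable_unit4.
apply: measurable_fun_eqr => //.
exact: (measurableT_comp measurable_dot4 measurable_unit4).
Qed.

HB.instance Definition _ :=
  isMeasurableFun.Build _ _ _ _ radial measurable_radial.

(* The law of [v / |v|] for [v] uniform in the unit ball of R^4, that is, the
   normalized Riemannian volume of the round sphere (each Borel set gets the
   normalized Lebesgue measure of the cone over it). The second argument of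
   [mnormalize] is a fallback for mass 0 or +oo and plays no role. *)
Definition sphere3_unif : set sphere3 -> \bar R :=
  distribution (mnormalize (mrestr lebesgue4 measurable_ball4) \d_(point : R4))
    radial.

HB.instance Definition _ := Probability.on sphere3_unif.

End sphere3.

Section lens.
Context (R : realType) (n : nat).

Definition Zn : set R[i] := [set w | w ^+ n = 1].

Definition Zn_act (w : R[i]) (p : R[i] * R[i]) : R[i] * R[i] :=
  (w * p.1, w * p.2).

Definition lens_rel (p q : sphere3 R) : bool :=
  `[< exists2 w, Zn w & Zn_act w p = q >].

Lemma lens_rel_refl : reflexive lens_rel.
Proof.
move=> p; apply/asboolP; exists 1; first by rewrite /Zn /= expr1n.
by rewrite /Zn_act !mul1r -surjective_pairing.
Qed.

Lemma lens_rel_sym : symmetric lens_rel.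
Proof.
suff h p q : lens_rel p q -> lens_rel q p by move=> p q; apply/idP/idP; exact: h.
move=> /asboolP[w wn pq]; apply/asboolP; exists w^-1.
  by rewrite /Zn /= exprVn wn invr1.
have w0 : w != 0.
  apply/eqP => w0; have := sphere3P q.
  by rewrite -pq /on_sphere3 w0 /= !mul0r normr0 expr0n addr0 eq_sym oner_eq0.
by rewrite -pq /Zn_act /= !mulKf// -surjective_pairing.
Qed.

Lemma lens_rel_trans : transitive lens_rel.
Proof.
move=> q p r /asboolP[w wn pq] /asboolP[w' wn' qr].
apply/asboolP; exists (w' * w); first by rewrite /Zn /= exprMn wn wn' mulr1.
by rewrite -qr -pq /Zn_act /= !mulrA.
Qed.

Definition lens_equiv : equiv_rel (sphere3 R) :=
  EquivRel lens_rel lens_rel_refl lens_rel_sym lens_rel_trans.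

Definition lens : Type := {eq_quot lens_equiv}.

HB.instance Definition _ := Quotient.on lens.
HB.instance Definition _ := Choice.on lens.
HB.instance Definition _ := isPointed.Build lens (\pi_lens point).

Definition lens_proj (p : sphere3 R) : lens := \pi_lens p.

Definition lens_display : measure_display. Proof. exact. Qed.

Definition lens_measurable : set (set lens) :=
  image_set_system setT lens_proj measurable.

Lemma lens_sigma_algebra : sigma_algebra setT lens_measurable.
Proof. exact/sigma_algebra_image/sigma_algebra_measurable. Qed.

Lemma lens_measurable0 : lens_measurable set0.
Proof. by case: lens_sigma_algebra. Qed.

Lemma lens_measurableC A : lens_measurable A -> lens_measurable (~` A).
Proof. by case: lens_sigma_algebra => _ + _; rewrite -setTD; exact. Qed.

Lemma lens_measurable_bigcup (F : (set lens)^nat) :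
  (forall i, lens_measurable (F i)) -> lens_measurable (\bigcup_i F i).
Proof. by case: lens_sigma_algebra => _ _; exact. Qed.

(* The quotient sigma-algebra; for [0 < n], it is also the Borel sigma-algebra of
   the quotient topology. *)
HB.instance Definition _ := @isMeasurable.Build lens_display lens
  lens_measurable lens_measurable0 lens_measurableC lens_measurable_bigcup.

Lemma measurable_lens_proj : measurable_fun setT lens_proj.
Proof. by move=> _ A. Qed.

HB.instance Definition _ :=
  isMeasurableFun.Build _ _ _ _ lens_proj measurable_lens_proj.

(* The value does not depend on the choice of representatives; [inf] is a
   minimum, since [Zn] is finite and nonempty when [0 < n]. *)
Definition lens_dist (x y : lens) : R :=
  let p : sphere3 R := repr x in let q : sphere3 R := repr y in
  inf [set dist_sphere3 (Zn_act w p) q | w in Zn].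

Definition lens_unif : set lens -> \bar R :=
  distribution (@sphere3_unif R) lens_proj.

HB.instance Definition _ := Probability.on lens_unif.

Definition lens_moment (k : nat) : \bar R :=
  'E_(lens_unif \x lens_unif)%E[(fun z => lens_dist z.1 z.2 ^+ k)].

End lens.

Section formula.
Context (R : realType).

Definition pochhammer (a : R) (j : nat) : R := \prod_(i < j) (a + i%:R).

Definition hypergeometric_1F2 (a b1 b2 z : R) : R :=
  limn (series (fun j => pochhammer a j / (pochhammer b1 j * pochhammer b2 j) *
                         (z ^+ j / j`!%:R))).

Definition lens_moment_formula (k : nat) (n : R) : R :=
  ((k + 1) * (k + 2))%:R^-1 *
  (4 / (k + 3)%:R * (pi / n) ^+ (k + 2) *
     hypergeometric_1F2 1 ((k + 4)%:R / 2) ((k + 5)%:R / 2)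
       (- (pi ^+ 2 / n ^+ 2))
   + tan (pi / n) *
     (n * (pi / 2) ^+ (k + 1) *
        hypergeometric_1F2 1 ((k + 3)%:R / 2) ((k + 4)%:R / 2)
          (- (pi ^+ 2 / 4))
      - 2 * (pi / n) ^+ (k + 1) *
        hypergeometric_1F2 1 ((k + 3)%:R / 2) ((k + 4)%:R / 2)
          (- (pi ^+ 2 / n ^+ 2)))).

End formula.

(* Main.v *)
Require Import Defs.
From mathcomp Require Import all_boot all_order all_algebra.
From mathcomp Require Import generic_quotient complex ring lra zify.
From mathcomp Require Import all_classical all_reals all_analysis.
From mathcomp Require Import measurable_realfun.

(* SU(2) acts transitively on S^3 and commutes with Z_n, so the moment is the
   integral over q of d([1, 0], [q])^k. Since max over w of Re (w alpha) is the
   cosine of that distance and alpha is uniform in the unit disk when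
   q = (alpha, beta) is uniform on S^3, cutting the disk into n sectors permuted
   by Z_n reduces the moment to the mean of (arccos x)^k over the sector
   |arg z| <= pi / n of the disk. Slicing the sector vertically and putting
   x = cos t leaves the integrals of t^k sin^2 t over [0, pi / n] and of
   tan (pi / n) t^k sin t cos t over [pi / n, pi / 2]. The 1F2 series come from
   integrating t^k sin (2 (a - t)) over [0, a] repeatedly by parts. *)

Set Implicit Arguments.
Unset Strict Implicit.
Unset Printing Implicit Defensive.

Import Order.TTheory GRing.Theory Num.Theory.
Import numFieldNormedType.Exports.

Local Open Scope classical_set_scope.
Local Open Scope ring_scope.

(** * Invariance properties of Lebesgue measure *)

Section lebesgue1.
Context {R : realType}.
Local Notation mR := (measurableTypeR R).
Local Notation mu := (@lebesgue_measure R).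
Local Open Scope ereal_scope.

(** Invariance under SU(2) is obtained without a determinant change of variables. A matrix of
    SL_2(C) is a product of complex shears, and a shear translates one coordinate by an amount
    depending on the other, so Tonelli and translation invariance suffice. Points of the lens space
    are seen only through arbitrary representatives, and the moment integrates over a product of two
    quotient sigma-algebras. The distance therefore has to be built from Z_n-invariant functions of
    each point separately. This works because the maximum of Re (w z) over roots of unity w depends
    on z ^ n only, and the nth power of a Hermitian product is a sum of products of invariant
    monomials. For n = 2 the sides of the sector lie on the imaginary axis, where the tangent has
    its pole. All n >= 2 are treated together by discarding a null hyperplane and by keeping the
    tangent as a factor of an integral over [pi / n, pi / 2], a single point when n = 2. Integrating
    by parts raises the exponent of t, so the remainder is dominated by the terms of an exponential
    series. *)

Lemma ge0_integral_shift (c : R) (f : measurableTypeR R -> \bar R) :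
  measurable_fun setT f -> (forall x, 0 <= f x) ->
  \int[mu]_x f (x + c)%R = \int[mu]_x f x.
Proof.
move=> mf f0.
pose phi : measurableTypeR R -> measurableTypeR R := fun x => (x + c)%R.
have mphi : measurable_fun setT phi by exact: measurable_funD.
transitivity (\int[pushforward mu phi]_x f x).
  by rewrite ge0_integral_pushforward.
have phiE (a b : R) : phi @^-1` `]a, b] = `](a - c)%R, (b - c)%R]%classic.
  by apply/seteqP; split => x /=; rewrite /phi !in_itv/= ltrBlDr lerBrDr.
(* Lebesgue measure is the only measure that gives half-open intervals their length, so the
   push-forward is compared with it on those alone. *)
apply: eq_measure_integral => A mA _; apply/esym/(lebesgue_measure_unique) => //=.
move=> _ [[a b]] _ <-.
rewrite /pushforward (phiE a b) !lebesgue_measure_itv/= !lte_fin ltrD2r;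
  case: ifPn => // _.
by rewrite -!EFinB opprB addrA addrNK.
Qed.

(** The push-forward under x -> t x shrinks lengths by t; multiplied by t, it is Lebesgue measure by
    the same uniqueness. *)
Lemma ge0_integral_scale (t : R) (f : measurableTypeR R -> \bar R) :
  (0 < t)%R -> measurable_fun setT f -> (forall x, 0 <= f x) ->
  \int[mu]_x f x = t%:E * \int[mu]_x f (t * x)%R.
Proof.
move=> t0 mf f0.
pose phi : measurableTypeR R -> measurableTypeR R := fun x => (t * x)%R.
have mphi : measurable_fun setT phi by exact: measurable_funM.
rewrite -[X in _ = _ * X]/(\int[mu]_(x in phi @^-1` setT) (f \o phi) x).
rewrite -(ge0_integral_pushforward mphi mu measurableT)//.
rewrite -[t%:E]/((NngNum (ltW t0))%:num%:E) -ge0_integral_mscale//.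
have phiE (a b : R) : phi @^-1` `]a, b] = `](a / t)%R, (b / t)%R]%classic.
  by apply/seteqP; split => x /=;
    rewrite /phi !in_itv/= ltr_pdivrMr// ler_pdivlMr// mulrC.
apply: eq_measure_integral => A mA _; apply/(lebesgue_measure_unique) => //=.
move=> _ [[a b]] _ <-.
rewrite /mscale/= /pushforward (phiE a b) !lebesgue_measure_itv/= !lte_fin
  ltr_pM2r ?invr_gt0//.
case: ifPn => // _; last by rewrite mule0.
by rewrite -!EFinB -EFinM -mulrBl mulrC divfK ?gt_eqF.
Qed.

End lebesgue1.

Section lebesgue2.
Context {R : realType}.
Local Notation mR := (measurableTypeR R).
Local Notation R2 := (mR * mR)%type.
Local Notation mu := (@lebesgue_measure R).
Local Open Scope ereal_scope.

Lemma ge0_integral_lebesgue2 (f : R2 -> \bar R) :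
  measurable_fun setT f -> (forall z, 0 <= f z) ->
  \int[@lebesgue2 R]_z f z = \int[mu]_x \int[mu]_y f (x, y).
Proof. by move=> mf f0; exact: (fubini_tonelli1 f). Qed.

Lemma ge0_integral_shift2 (c : R2) (f : R2 -> \bar R) :
  measurable_fun setT f -> (forall z, 0 <= f z) ->
  \int[@lebesgue2 R]_z f (z.1 + c.1, z.2 + c.2)%R = \int[@lebesgue2 R]_z f z.
Proof.
move=> mf f0; rewrite !ge0_integral_lebesgue2//; last first.
  apply: (measurableT_comp mf).
  by apply: measurable_fun_pair; apply: measurable_funD.
under eq_integral => x _.
  rewrite /= (@ge0_integral_shift R c.2 (fun y => f ((x + c.1)%R, y)))//; last first.
    by apply: (measurableT_comp mf); exact: measurable_fun_pair.
  over.
rewrite (@ge0_integral_shift R c.1 (fun x => \int[mu]_y f (x, y)))//.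
  exact: (measurable_fun_fubini_tonelli_F f).
by move=> x; exact: integral_ge0.
Qed.

Lemma ge0_integral_scale2 (t : R) (f : R2 -> \bar R) : (0 < t)%R ->
  measurable_fun setT f -> (forall z, 0 <= f z) ->
  \int[@lebesgue2 R]_z f z =
  (t ^+ 2)%:E * \int[@lebesgue2 R]_z f (t * z.1, t * z.2)%R.
Proof.
move=> t0 mf f0.
have mft : measurable_fun setT (fun z : R2 => f (t * z.1, t * z.2)%R).
  apply: (measurableT_comp mf).
  by apply: measurable_fun_pair; apply: measurable_funM.
rewrite !ge0_integral_lebesgue2//.
rewrite (@ge0_integral_scale _ t)//; last 2 first.
  exact: (measurable_fun_fubini_tonelli_F f).
  by move=> x; exact: integral_ge0.
under eq_integral => x _.
  rewrite /= (@ge0_integral_scale _ t (fun y => f ((t * x)%R, y)))//; last first.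
    by apply: (measurableT_comp mf); exact: measurable_fun_pair.
  over.
rewrite ge0_integralZl//; last 3 first.
- by apply: (measurable_fun_fubini_tonelli_F _ mft) => z.
- by move=> x _; exact: integral_ge0.
- by rewrite lee_fin ltW.
by rewrite muleA -EFinM.
Qed.

End lebesgue2.

(** * Complex linear maps of C^2 with determinant 1 *)

Section complex_shears.
Local Open Scope complex_scope.
Context {R : realType}.
Local Notation mR := (measurableTypeR R).
Local Notation R2 := (mR * mR)%type.
Local Notation R4 := (R2 * R2)%type.

(** Integrals and measurability live on pairs of reals; through this injection, algebraic identities
    are checked in R[i]. *)
Definition toC (z : R2) : R[i] := z.1 +i* z.2.

Definition addp (z w : R2) : R2 := (z.1 + w.1, z.2 + w.2).

Definition mulp (u : R[i]) (z : R2) : R2 :=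
  (complex.Re u * z.1 - complex.Im u * z.2,
   complex.Re u * z.2 + complex.Im u * z.1).

Lemma toC_inj : injective toC.
Proof. by move=> [x y] [x' y'] [/= -> ->]. Qed.

Lemma toC_addp z w : toC (addp z w) = toC z + toC w.
Proof. by []. Qed.

Lemma toC_mulp u z : toC (mulp u z) = u * toC z.
Proof. by case: u. Qed.

Definition mat2 (a b c d : R[i]) (v : R4) : R4 :=
  (addp (mulp a v.1) (mulp b v.2), addp (mulp c v.1) (mulp d v.2)).

Local Arguments mat2 (_ _ _ _)%_R _.

Lemma mat2_comp a b c d a' b' c' d' v :
  mat2 a b c d (mat2 a' b' c' d' v) =
  mat2 (a * a' + b * c') (a * b' + b * d')
       (c * a' + d * c') (c * b' + d * d') v.
Proof.
rewrite /mat2; congr (_, _); apply: toC_inj;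
  by rewrite !(toC_addp, toC_mulp); move: (toC v.1) (toC v.2) => x y; ring.
Qed.

Lemma measurable_addp d (T : measurableType d) (f g : T -> R2) :
  measurable_fun setT f -> measurable_fun setT g ->
  measurable_fun setT (fun x => addp (f x) (g x)).
Proof.
by move=> mf mg; apply: measurable_fun_pair; apply: measurable_funD;
  apply: measurableT_comp.
Qed.

Lemma measurable_mulp d (T : measurableType d) u (f : T -> R2) :
  measurable_fun setT f -> measurable_fun setT (fun x => mulp u (f x)).
Proof.
move=> mf; apply: measurable_fun_pair.
  by apply: measurable_funB; apply: measurable_funM => //;
    apply: measurableT_comp.
by apply: measurable_funD; apply: measurable_funM => //; apply: measurableT_comp.
Qed.

Lemma measurable_mat2 a b c d : measurable_fun setT (mat2 a b c d).
Proof.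
by apply: measurable_fun_pair; apply: measurable_addp; apply: measurable_mulp.
Qed.

Local Open Scope ereal_scope.

Lemma ge0_integral_lebesgue4_1 (f : R4 -> \bar R) :
  measurable_fun setT f -> (forall v, 0 <= f v) ->
  \int[@lebesgue4 R]_v f v =
  \int[@lebesgue2 R]_z \int[@lebesgue2 R]_w f (z, w).
Proof. by move=> mf f0; exact: (fubini_tonelli1 f). Qed.

Lemma ge0_integral_lebesgue4_2 (f : R4 -> \bar R) :
  measurable_fun setT f -> (forall v, 0 <= f v) ->
  \int[@lebesgue4 R]_v f v =
  \int[@lebesgue2 R]_w \int[@lebesgue2 R]_z f (z, w).
Proof. by move=> mf f0; exact: (fubini_tonelli2 f). Qed.

(** Phrased with integrals of nonnegative functions rather than measures of sets, so that it can be
    proved slice by slice with Tonelli and passes to compositions. *)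
Definition preserving4 (g : R4 -> R4) :=
  forall f : R4 -> \bar R, measurable_fun setT f -> (forall v, 0 <= f v) ->
  \int[@lebesgue4 R]_v f (g v) = \int[@lebesgue4 R]_v f v.

(** With the second coordinate w fixed, the map translates the first one by u w. *)
Lemma preserving_upper u : preserving4 (mat2 1 u 0 1).
Proof.
move=> f mf f0.
have mg := measurableT_comp mf (measurable_mat2 1%R u 0%R 1%R).
rewrite (ge0_integral_lebesgue4_2 mg (fun v => f0 _)) (ge0_integral_lebesgue4_2 mf)//.
apply: eq_integral => w _.
rewrite -(@ge0_integral_shift2 _ (mulp u w) (fun z => f (z, w)))//; last first.
  by apply: (measurableT_comp mf); exact: measurable_fun_pair.
apply: eq_integral => z _; congr f.
rewrite /mat2 -/(addp _ _); congr (_, _); apply: toC_inj;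
  by rewrite !(toC_addp, toC_mulp) ?(mul1r, mul0r, add0r).
Qed.

Lemma preserving_lower u : preserving4 (mat2 1 0 u 1).
Proof.
move=> f mf f0.
have mg := measurableT_comp mf (measurable_mat2 1%R 0%R u 1%R).
rewrite (ge0_integral_lebesgue4_1 mg (fun v => f0 _)) (ge0_integral_lebesgue4_1 mf)//.
apply: eq_integral => z _.
rewrite -(@ge0_integral_shift2 _ (mulp u z) (fun w => f (z, w)))//; last first.
  by apply: (measurableT_comp mf); exact: measurable_fun_pair.
apply: eq_integral => w _; congr f.
rewrite /mat2 -/(addp _ _); congr (_, _); apply: toC_inj;
  by rewrite !(toC_addp, toC_mulp) ?(mul1r, mul0r, addr0)// addrC.
Qed.

Lemma preserving_comp g h : measurable_fun setT g ->
  preserving4 g -> preserving4 h -> preserving4 (g \o h).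
Proof.
move=> mg pg ph f mf f0; rewrite -(pg f)//.
exact: (ph (f \o g) (measurableT_comp mf mg) (fun v => f0 _)).
Qed.

(** Three shears suffice: the middle one produces c, the outer two adjust the diagonal to a and d,
    and the determinant then forces b. *)
Lemma preserving_sl2_neq0 a b c d : (c != 0)%R -> (a * d - b * c = 1)%R ->
  preserving4 (mat2 a b c d).
Proof.
move=> c0 det.
have -> : mat2 a b c d = mat2 1 ((a - 1) / c) 0 1 \o
    (mat2 1 0 c 1 \o mat2 1 ((d - 1) / c) 0 1).
  apply/funext => v /=; rewrite !mat2_comp.
  have -> : b = ((a * d - 1) / c)%R by rewrite -det; field.
  by congr (mat2 _ _ _ _ v); field.
apply: preserving_comp; [exact: measurable_mat2|exact: preserving_upper|].
apply: preserving_comp; [exact: measurable_mat2|exact: preserving_lower|].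
exact: preserving_upper.
Qed.

(** If c = 0, then d is nonzero; splitting off the quarter turn with rows (0, 1) and (-1, 0) leaves
    two factors whose lower left entries, d and -1, are nonzero. *)
Lemma preserving_sl2 a b c d : (a * d - b * c = 1)%R ->
  preserving4 (mat2 a b c d).
Proof.
move=> det; have [c0|] := eqVneq c 0%R; last first.
  by move=> c0; exact: preserving_sl2_neq0.
have d0 : (d != 0)%R.
  by apply/eqP => d0; move: det; rewrite c0 d0 !mulr0 subr0 => /esym/eqP;
    rewrite oner_eq0.
have -> : mat2 a b c d = mat2 b (- a) d (- c) \o mat2 0 1 (-1) 0.
  by apply/funext => v /=; rewrite mat2_comp; congr (mat2 _ _ _ _ v); ring.
apply: preserving_comp; first exact: measurable_mat2.
  by apply: preserving_sl2_neq0 => //; rewrite -det; ring.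
by apply: preserving_sl2_neq0; rewrite ?oppr_eq0 ?oner_eq0//; ring.
Qed.

End complex_shears.

(** * The first complex coordinate of a uniform point of the ball *)

Section restriction.
Local Open Scope ereal_scope.
Context d (T : measurableType d) (R : realType).
Variable mu : {measure set T -> \bar R}.

Lemma measurable_setb (b : T -> bool) :
  measurable_fun setT b -> measurable [set x | b x].
Proof.
by move=> mb; have := mb measurableT [set true] I; rewrite setTI.
Qed.

Lemma integral_if (b : T -> bool) (f : T -> \bar R) :
  \int[mu]_(x in [set x | b x]) f x = \int[mu]_x (if b x then f x else 0).
Proof.
rewrite integral_mkcond; apply: eq_integral => x _; rewrite patchE.
by case: ifPn => [/set_mem/= ->//|/negP]; rewrite inE/= => /negP/negbTE ->.
Qed.

Lemma measure_if (b : T -> bool) : measurable [set x | b x] ->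
  mu [set x | b x] = \int[mu]_x (if b x then 1 else 0).
Proof. by move=> mb; rewrite -integral_if integral_cst// mul1e. Qed.

Lemma ge0_integral_mrestr (D : set T) (mD : measurable D) (f : T -> \bar R) :
  measurable_fun setT f -> (forall x, 0 <= f x) ->
  \int[mrestr mu mD]_x f x = \int[mu]_(x in D) f x.
Proof.
move=> mf f0; rewrite -(setvU D) (ge0_integral_setU _ (measurableC mD) mD)//;
  last 2 first.
- exact: measurable_funS mf.
- by apply/disj_setPS => x [].
rewrite null_set_integral ?add0e//=; last 3 first.
- exact: measurableC.
- exact: measurable_funS mf.
- by rewrite /mrestr/= setICl measure0.
by apply: eq_measure_integral => A mA AD; rewrite /= /mrestr setIidl.
Qed.

End restriction.

Section radial.
Context {R : realType}.
Local Notation mR := (measurableTypeR R).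
Local Notation R2 := (mR * mR)%type.
Local Notation R4 := (R2 * R2)%type.
Local Notation mu := (@lebesgue_measure R).

Definition norm2 (z : R2) : mR := z.1 ^+ 2 + z.2 ^+ 2.

Lemma norm2_ge0 z : 0 <= norm2 z :> R.
Proof. by rewrite addr_ge0 ?sqr_ge0. Qed.

Lemma measurable_norm2 : measurable_fun setT norm2.
Proof.
by apply: measurable_funD; apply: measurable_funX.
Qed.

Local Open Scope ereal_scope.

(* The value pi is not needed: this factor is eliminated at the end by the case
   k = 0, where the moment is 1. *)
Definition disk_area : \bar R := @lebesgue2 R [set z | norm2 z < 1]%R.

Lemma measurable_norm2_lt (r : R) : measurable [set z | (norm2 z < r)%R].
Proof.
by apply: measurable_setb; apply: measurable_fun_ltr => //; exact: measurable_norm2.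
Qed.

Lemma disk_area_fin_num : disk_area \is a fin_num.
Proof.
rewrite ge0_fin_numE ?measure_ge0//.
apply: (@le_lt_trans _ _ (@lebesgue2 R (`[(-1)%R, 1%R] `*` `[(-1)%R, 1%R]))).
  apply: le_measure; rewrite ?inE; [exact: measurable_norm2_lt|exact: measurableX|].
  move=> [x y]; rewrite /norm2/= !in_itv/= => xy1.
  by split; apply/andP; split; nra.
  rewrite /lebesgue2 product_measure1E//= lebesgue_measure_itv/=.
  by case: ifP => _; rewrite ?mul0e -?EFinB -?EFinM ltry.
Qed.

Lemma disk_area_gt0 : 0 < disk_area.
Proof.
apply: (@lt_le_trans _ _ (@lebesgue2 R (`[0%R, 2^-1%R] `*` `[0%R, 2^-1%R]))).
  rewrite /lebesgue2 product_measure1E//= lebesgue_measure_itv/= lte_fin invr_gt0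
    ltr0n/=.
  by rewrite oppr0 adde0 -EFinM lte_fin; lra.
apply: le_measure; rewrite ?inE; [exact: measurableX|exact: measurable_norm2_lt|].
move=> [x y]; rewrite /norm2/= !in_itv/= => -[]; nra.
Qed.

(** Scaling by [Num.sqrt r] maps the unit disk onto this one and multiplies areas by r; the maximum
    accounts for the empty disk when r <= 0. *)
Lemma lebesgue2_disk (r : R) :
  @lebesgue2 R [set z | norm2 z < r]%R = (Num.max r 0)%:E * disk_area.
Proof.
have [r0|r0] := ltP 0%R r; last first.
  rewrite mul0e [X in lebesgue2 X](_ : _ = set0)//.
  apply/seteqP; split => // z /= zr.
  by move: (lt_le_trans zr r0); rewrite ltNge norm2_ge0.
rewrite /disk_area !measure_if; try exact: measurable_norm2_lt.
have s0 : (0 < Num.sqrt r)%R by rewrite sqrtr_gt0.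
rewrite (@ge0_integral_scale2 _ (Num.sqrt r))//; last 2 first.
- by apply: measurable_fun_ifT => //; apply: measurable_fun_ltr => //;
    exact: measurable_norm2.
- by move=> z; case: ifP.
rewrite sqr_sqrtr ?(ltW r0)//; congr (_ * _); apply: eq_integral => z _.
by rewrite /norm2/= !exprMn sqr_sqrtr ?(ltW r0)// -mulrDr gtr_pMr.
Qed.

Lemma ge0_integral_radial (g : mR -> \bar R) :
  measurable_fun setT g -> (forall s, 0 <= g s) ->
  \int[@lebesgue2 R]_w g (norm2 w) =
  disk_area * \int[mu]_(s in `]0%R, +oo[) g s.
Proof.
move=> mg g0.
have mI : measurable (`]0%R, +oo[%classic : set mR) by exact: measurable_itv.
have c0 : (0 <= fine disk_area)%R by rewrite fine_ge0// ltW// disk_area_gt0.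
rewrite -(ge0_integral_mrestr mu mI mg g0) -(fineK disk_area_fin_num).
rewrite -[(fine disk_area)%:E]/((NngNum c0)%:num%:E) -ge0_integral_mscale//.
rewrite -[LHS]/(\int[_]_(w in norm2 @^-1` setT) (g \o norm2) w).
rewrite -(ge0_integral_pushforward measurable_norm2 _ measurableT)//.
have key (k : R) : @lebesgue2 R [set z | norm2 z < k]%R =
    (fine disk_area)%:E * mu (`]-oo, k[ `&` `]0%R, +oo[)%classic.
  rewrite lebesgue2_disk fineK ?disk_area_fin_num// muleC; congr (_ * _).
  rewrite (_ : _ `&` _ = `]0%R, k[%classic).
    rewrite lebesgue_measure_itv/= lte_fin oppr0 adde0.
    by case: ltP.
  by apply/seteqP; split => x /=; rewrite !in_itv/= andbT;
    [move=> [-> ->]|move=> /andP[-> ->]].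
apply: eq_measure_integral => [|mN A mA _]; first exact: measurable_norm2.
(* The rays ]-oo, k[ are stable under intersection and generate the Borel sets, and those with
   natural k exhaust the line with finite mass; on rays, both measures are given by
   [lebesgue2_disk]. *)
apply: (@measure_unique _ R mR (@RGenInftyO.G R)
  (fun k => `]-oo, k%:R[%classic)) => //.
- exact: RGenInftyO.measurableE.
- move=> _ _ [x ->] [y ->]; exists (Num.min x y).
  by apply/seteqP; split => z /=; rewrite !in_itv/= lt_min => /andP.
- by move=> k; exists k%:R.
- apply/seteqP; split => // x _; exists (Num.bound `|x|%R) => //=.
  by rewrite in_itv/= (le_lt_trans (ler_norm x))// archi_boundP.
- by move=> _ [k ->]; rewrite /= /mscale/= /mrestr/= -key.
- move=> k; rewrite /= /pushforward.
  rewrite (_ : _ @^-1` _ = [set z | norm2 z < k%:R]%R); last first.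
    by apply/seteqP; split => z /=; rewrite in_itv.
  by rewrite lebesgue2_disk -(fineK disk_area_fin_num) -EFinM ltry.
Qed.

Definition proj4 (v : R4) : R2 :=
  (v.1.1 / Num.sqrt (dot4 v v), v.1.2 / Num.sqrt (dot4 v v))%R.

Lemma measurable_sqrtV d (T : measurableType d) (f : T -> R) :
  measurable_fun setT f -> measurable_fun setT (fun x => (Num.sqrt (f x))^-1%R).
Proof.
move=> mf.
(* Real powers replace the root and the inverse; clamping at 0 matches [Num.sqrt], which is 0 on
   negative numbers. *)
have -> : (fun x => (Num.sqrt (f x))^-1)%R =
    (fun x => ((Num.max (f x) 0) `^ 2^-1) `^ (-1))%R.
  apply/funext => x; rewrite powR_inv1 ?powR_ge0// powR12_sqrt ?le_max ?lexx ?orbT//.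
  by have [//|fx0] := leP 0%R (f x); rewrite sqrtr0 (ler0_sqrtr (ltW fx0)).
apply: (measurableT_comp (measurable_powR (-1))).
by apply: (measurableT_comp (measurable_powR 2^-1)); exact: measurable_maxr.
Qed.

(** The contribution of the radial variable r in [ge0_integral_ball4]. *)
Lemma integral_id01 : \int[mu]_r (if (0 < r <= 1)%R then r%:E else 0) = (2^-1%R)%:E.
Proof.
rewrite -integral_if (_ : [set x : R | (0 < x <= 1)%R] = `]0%R, 1%R]%classic);
  last first.
  by apply/seteqP; split => x /=; rewrite in_itv.
rewrite integral_itv_obnd_cbnd; last first.
  by apply/measurable_EFinP; exact: measurable_id.
rewrite (@continuous_FTC2 _ _ (fun x => x ^+ 2 / 2)%R)//.
- by rewrite expr1n expr0n mul0r sube0 mul1r.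
- by apply: continuous_subspaceT => x; exact: cvg_id.
- split.
  + by move=> x _; exact: derivableM.
  + by apply: cvg_at_right_filter; apply: cvgM;
      [exact: exprn_continuous|exact: cvg_cst].
  + by apply: cvg_at_left_filter; apply: cvgM; [exact: exprn_continuous|exact: cvg_cst].
- move=> x _; rewrite derive1E deriveM// derive_cst scaler0 add0r.
  by rewrite exp_derive /= expr1 -mulr_natl scaler1 scalerA mulVf ?scale1r//.
Qed.

(* Since s = |w|^2 has density [disk_area] on the positive half-line, putting
   r = |z|^2 + s and then scaling z by sqrt r separates the variables. *)
Lemma ge0_integral_ball4 (psi : R2 -> \bar R) :
  measurable_fun setT psi -> (forall z, 0 <= psi z) ->
  \int[@lebesgue4 R]_(v in @ball4 R) psi (proj4 v) =
  disk_area * (2^-1%R)%:E *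
  \int[@lebesgue2 R]_(z in [set z | norm2 z < 1]%R) psi z.
Proof.
move=> mpsi psi0; rewrite [LHS]integral_if integral_if.
pose q (z : R2) (r : R) : R2 := (z.1 / Num.sqrt r, z.2 / Num.sqrt r)%R.
have mq d (T : measurableType d) (f : T -> R2) (g : T -> R) :
    measurable_fun setT f -> measurable_fun setT g ->
    measurable_fun setT (fun x => psi (q (f x) (g x))).
  move=> mf mg; apply: (measurableT_comp mpsi).
  by apply: measurable_fun_pair; apply: measurable_funM;
    (try exact: measurable_sqrtV); apply: measurableT_comp.
pose F (u : R2 * mR) : \bar R :=
  if (norm2 u.1 + u.2 <= 1)%R then psi (q u.1 (norm2 u.1 + u.2)%R) else 0.
have mN1 : measurable_fun setT (fun u : R2 * mR => norm2 u.1).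
  exact: (measurableT_comp measurable_norm2).
have mF : measurable_fun setT F.
  have mN : measurable_fun setT (fun u : R2 * mR => (norm2 u.1 + u.2)%R).
    exact: measurable_funD.
  by apply: measurable_fun_ifT => //; [exact: measurable_fun_ler|exact: mq].
have F0 u : 0 <= F u by rewrite /F; case: ifP.
pose G (u : R2 * mR) : \bar R :=
  if (norm2 u.1 < u.2)%R && (u.2 <= 1)%R then psi (q u.1 u.2) else 0.
have mG : measurable_fun setT G.
  apply: measurable_fun_ifT => //; last exact: mq.
  by apply: measurable_and; [exact: measurable_fun_ltr|exact: measurable_fun_ler].
have G0 u : 0 <= G u by rewrite /G; case: ifP.
transitivity (\int[@lebesgue2 R]_z \int[@lebesgue2 R]_w F (z, norm2 w)).
  rewrite (@ge0_integral_lebesgue4_1 _ (fun v => F (v.1, norm2 v.2)))//.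
  apply: (measurableT_comp mF); apply: measurable_fun_pair => //.
  exact: (measurableT_comp measurable_norm2).
transitivity (\int[@lebesgue2 R]_z (disk_area * \int[mu]_r G (z, r))).
  apply: eq_integral => z _.
  rewrite (@ge0_integral_radial (fun s => F (z, s)))//; last first.
    by apply: (measurableT_comp mF); exact: measurable_fun_pair.
  congr (_ * _).
  rewrite (_ : `]0%R, +oo[%classic = [set s : mR | (0 < s)%R]); last first.
    by apply/seteqP; split => s /=; rewrite in_itv/= andbT.
  (* The shift s = r - |z|^2 turns the condition s > 0 into |z|^2 < r, and [F] into [G]. *)
  rewrite integral_if -(@ge0_integral_shift _ (- norm2 z)%R
    (fun s => if (0 < s)%R then F (z, s) else 0)).
  - apply: eq_integral => r _; rewrite /= subr_gt0 /F /G/= addrC subrK.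
    by case: ifP.
  - apply: measurable_fun_ifT => //; first exact: measurable_fun_ltr.
    by apply: (measurableT_comp mF); exact: measurable_fun_pair.
  - by move=> s; case: ifP.
rewrite ge0_integralZl//; last 3 first.
- exact: (measurable_fun_fubini_tonelli_F _ mG).
- by move=> z _; exact: integral_ge0.
- exact: ltW disk_area_gt0.
rewrite -muleA; congr (_ * _).
(* With z as the inner variable, scaling it by [Num.sqrt r] turns |z|^2 < r into |z|^2 < 1, removes
   r from the argument of [psi] and leaves the Jacobian factor r. *)
rewrite [LHS](@fubini_tonelli _ _ _ _ _ (@lebesgue2 R) mu G mG G0).
set K := (X in _ = _ * X).
transitivity (\int[mu]_r ((if (0 < r <= 1)%R then r%:E else 0) * K)).
  apply: eq_integral => r _; case: ifPn => [/andP[r0 r1]|r01]; last first.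
    rewrite mul0e; apply: integral0_eq => z _; rewrite /G/=.
    case: ifPn => // /andP[zr r1]; case/negP: r01.
    by rewrite r1 (le_lt_trans _ zr)// norm2_ge0.
  have s0 : (0 < Num.sqrt r)%R by rewrite sqrtr_gt0.
  rewrite (@ge0_integral_scale2 _ (Num.sqrt r))//; last first.
    by apply: (measurableT_comp mG); exact: measurable_fun_pair.
  rewrite sqr_sqrtr ?(ltW r0)//; congr (_ * _); apply: eq_integral => z _.
  rewrite /G /= r1 andbT /norm2/= !exprMn sqr_sqrtr ?(ltW r0)// -mulrDr gtr_pMr//.
  case: ifP => // _; congr psi; rewrite /q/= !(mulrC (Num.sqrt r)).
  by rewrite !mulfK ?gt_eqF// -surjective_pairing.
rewrite ge0_integralZr//; last 3 first.
- apply: measurable_fun_ifT => //; apply: measurable_and;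
    [exact: measurable_fun_ltr|exact: measurable_fun_ler].
- by move=> r _; case: ifPn => // /andP[r0 _]; rewrite lee_fin ltW.
- by apply: integral_ge0 => z _; case: ifP.
by rewrite integral_id01.
Qed.

End radial.

(** * Sectors of the complex plane *)

Section acosc.
Local Open Scope complex_scope.
Context {R : realType}.
Implicit Types x t : R.

(* [acos] is [point] outside [-1, 1]; clamping makes it monotone, hence
   measurable. *)
Definition acosc x : R := acos (Num.max (-1) (Num.min x 1)).

Lemma clampP x : -1 <= Num.max (-1) (Num.min x 1) <= 1.
Proof. by rewrite le_max lexx/= ge_max ge_min lexx orbT andbT; lra. Qed.

Lemma acoscE x : -1 <= x <= 1 -> acosc x = acos x.
Proof. by move=> /andP[x1 x2]; rewrite /acosc min_l// max_r. Qed.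

Lemma acosc_ge0 x : 0 <= acosc x.
Proof. by rewrite acos_ge0// clampP. Qed.

Lemma acosc_lepi x : acosc x <= pi.
Proof. by rewrite acos_lepi// clampP. Qed.

Lemma acosc_cos t : `|t| <= pi -> acosc (cos t) = `|t|.
Proof.
move=> tpi; rewrite acoscE ?cos_geN1 ?cos_le1//.
have -> : cos t = cos `|t| by case: (ger0P t) => // _; rewrite cosN.
by rewrite cosK// in_itv/= normr_ge0.
Qed.

Lemma acosc_nonincreasing : nonincreasing_fun acosc.
Proof.
move=> x y xy.
have cl : Num.max (-1) (Num.min x 1) <= Num.max (-1) (Num.min y 1).
  have m : Num.min x 1 <= Num.min y 1 by rewrite le_min !ge_min xy lexx orbT.
  by rewrite ge_max !le_max lexx/= m orbT.
have cx := clampP x; have cy := clampP y.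
rewrite leNgt -ltr_cos ?in_itv/= ?acosc_ge0 ?acosc_lepi//.
by rewrite !acosK ?in_itv// -leNgt.
Qed.

Lemma measurable_acosc : measurable_fun setT acosc.
Proof. exact: nonincreasing_measurable acosc_nonincreasing. Qed.

End acosc.

Section sectors.
Local Open Scope complex_scope.
Context {R : realType}.
Implicit Types (r t : R) (z w : R[i]).
Local Notation Re := complex.Re.
Local Notation Im := complex.Im.

Definition expi t : R[i] := cos t +i* sin t.

Lemma expiD s t : expi (s + t) = expi s * expi t.
Proof. by rewrite /expi cosD sinD; apply/eqP;
  rewrite eq_complex/= addrC eqxx addrC eqxx. Qed.

Lemma expi0 : expi 0 = 1.
Proof. by rewrite /expi cos0 sin0. Qed.

Lemma expiX t n : expi t ^+ n = expi (n%:R * t).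
Proof.
elim: n => [|n IH]; first by rewrite mul0r expi0.
by rewrite exprS IH -expiD -natr1 mulrDl mul1r addrC.
Qed.

Lemma polarP z : z != 0 ->
  exists r t, [/\ 0 < r, - pi <= t <= pi & z = r%:C * expi t].
Proof.
case: z => x y; rewrite eq_complex/= => xy0.
have s0 : 0 < x ^+ 2 + y ^+ 2.
  rewrite lt_neqAle addr_ge0 ?sqr_ge0// andbT eq_sym.
  by rewrite paddr_eq0 ?sqr_ge0// !sqrf_eq0.
pose r := Num.sqrt (x ^+ 2 + y ^+ 2).
have r0 : 0 < r by rewrite sqrtr_gt0.
have r2 : r ^+ 2 = x ^+ 2 + y ^+ 2 by rewrite sqr_sqrtr// ltW.
have xr : -1 <= x / r <= 1.
  by rewrite ler_pdivlMr// ler_pdivrMr// mulN1r mul1r; apply/andP; split; nra.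
have cE : cos (acos (x / r)) = x / r by rewrite acosK// in_itv.
have sE : sin (acos (x / r)) = `|y| / r.
  rewrite sin_acos//; have -> : 1 - (x / r) ^+ 2 = (`|y| / r) ^+ 2.
    by rewrite !expr_div_n real_normK ?num_real// r2; field; rewrite gt_eqF.
  by rewrite sqrtr_sqr ger0_norm// divr_ge0// ltW.
have a0 := acos_ge0 xr; have api := acos_lepi xr.
have rE u : r * (u / r) = u by rewrite mulrC divfK// gt_eqF.
exists r; have [y0|y0] := leP 0 y.
  exists (acos (x / r)); split => //;
    first by rewrite api (le_trans _ a0)// oppr_le0 pi_ge0.
  apply/eqP; rewrite eq_complex/= cE sE ger0_norm// !mul0r subr0 addr0.
  by rewrite !rE !eqxx.
exists (- acos (x / r)); split => //.
  by rewrite lerN2 api/= (le_trans _ (pi_ge0 R))// oppr_le0.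
apply/eqP; rewrite eq_complex/= cosN sinN cE sE ltr0_norm// !mul0r subr0 addr0.
by rewrite mulNr opprK !rE !eqxx.
Qed.

Lemma Re_polar r t : Re (r%:C * expi t) = r * cos t.
Proof. by rewrite /= mul0r subr0. Qed.

Lemma Im_polar r t : Im (r%:C * expi t) = r * sin t.
Proof. by rewrite /= mul0r addr0. Qed.

Definition modulus z : R := Num.sqrt (Re z ^+ 2 + Im z ^+ 2).

Lemma modulus_polar r t : 0 <= r -> modulus (r%:C * expi t) = r.
Proof.
move=> r0; rewrite /modulus Re_polar Im_polar !exprMn -mulrDr cos2Dsin2 mulr1.
by rewrite sqrtr_sqr ger0_norm.
Qed.

Context (n : nat) (n2 : (2 <= n)%N).
Local Notation a := (pi / n%:R : R).

Let n0 : 0 < n%:R :> R. Proof. by rewrite ltr0n (leq_trans _ n2). Qed.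

Let a_gt0 : 0 < a. Proof. by rewrite divr_gt0// pi_gt0. Qed.

Let a_le : a <= pi / 2.
Proof. by rewrite ler_pM2l ?pi_gt0// lef_pV2 ?posrE// ler_nat. Qed.

Let naE : n%:R * a = pi. Proof. by rewrite mulrC divfK// gt_eqF. Qed.

(* [maxRe_pow (z ^+ n)] is the maximum of Re (w * z) over the n-th roots of unity
   w; going through [z ^+ n] makes the invariance under those roots manifest. *)
Definition maxRe_pow z : R :=
  modulus z `^ (n%:R^-1) * cos (acosc (Re z / modulus z) / n%:R).

Definition maxRe z : R := maxRe_pow (z ^+ n).

Lemma maxRe_root w z : w ^+ n = 1 -> maxRe (w * z) = maxRe z.
Proof. by move=> w1; rewrite /maxRe exprMn w1 mul1r. Qed.

Lemma maxRe0 : maxRe 0 = 0.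
Proof.
rewrite /maxRe /maxRe_pow expr0n gtn_eqF ?(leq_trans _ n2)// /modulus/=.
by rewrite expr0n addr0 sqrtr0 powR0 ?mul0r// invr_eq0 gt_eqF.
Qed.

(** Here [acosc (cos (n%:R * t)) / n%:R] is the distance from t to the nearest multiple of 2 pi / n,
    that is, the absolute angle left after rotating z into the central sector. *)
Lemma maxRe_polar r t : 0 < r ->
  maxRe (r%:C * expi t) = r * cos (acosc (cos (n%:R * t)) / n%:R).
Proof.
move=> r0; rewrite /maxRe exprMn expiX.
have -> : r%:C ^+ n = (r ^+ n)%:C by rewrite rmorphXn.
have rn0 : 0 < r ^+ n by rewrite exprn_gt0.
rewrite /maxRe_pow modulus_polar ?(ltW rn0)// Re_polar.
rewrite mulrAC divff ?gt_eqF// mul1r.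
by rewrite -powR_mulrn ?(ltW r0)// -powRrM mulfV ?gt_eqF// powRr1 ?(ltW r0).
Qed.

Lemma maxRe_polar_sector r t : 0 < r -> `|t| <= a ->
  maxRe (r%:C * expi t) = r * cos t.
Proof.
move=> r0 ta; rewrite maxRe_polar// acosc_cos; last first.
  by rewrite normrM (gtr0_norm n0) -naE ler_pM2l.
rewrite normrM (gtr0_norm n0) mulrAC divff ?gt_eqF// mul1r.
by case: (ger0P t) => // _; rewrite cosN.
Qed.

(** In the central sector both sides agree. Outside it |t| exceeds a, whereas the angle in
    [maxRe_polar] is at most a, and cos decreases on [0, pi]. *)
Lemma Re_le_maxRe z : Re z <= maxRe z.
Proof.
have [->|z0] := eqVneq z 0; first by rewrite maxRe0.
have [r [t [r0 /andP[t1 t2] ->]]] := polarP z0; rewrite Re_polar.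
have [ta|ta] := leP `|t| a; first by rewrite maxRe_polar_sector.
rewrite maxRe_polar// ler_pM2l//.
have -> : cos t = cos `|t| by case: (ger0P t) => // _; rewrite cosN.
have tpi : `|t| <= pi by rewrite ler_norml t1.
have b0 := acosc_ge0 (cos (n%:R * t)); have bpi := acosc_lepi (cos (n%:R * t)).
have ba : acosc (cos (n%:R * t)) / n%:R <= a by rewrite ler_pM2r ?invr_gt0.
have bn : 0 <= acosc (cos (n%:R * t)) / n%:R by rewrite divr_ge0// ltW.
rewrite leNgt ltr_cos ?in_itv/= ?normr_ge0 ?tpi ?bn//=.
  by rewrite -leNgt (le_trans ba)// ltW.
by rewrite (le_trans ba)// (le_trans (ltW ta)).
Qed.

Definition zeta : R[i] := expi (2 * a).

Lemma zetaX j : zeta ^+ j = expi (j%:R * (2 * a)).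
Proof. exact: expiX. Qed.

Lemma zeta_unity : zeta ^+ n = 1.
Proof. by rewrite zetaX mulrCA naE mulr_natl mulr2n /expi cosDpi sinDpi cospi
  sinpi opprK oppr0. Qed.

(** The witness is ceil x - 1. It counts the rotations by 2 a that bring an angle into the half-open
    range of the sector. *)
Lemma nat_ceil (m : nat) (x : R) : 0 < x <= m%:R ->
  exists2 j, (j < m)%N & 0 < x - j%:R <= 1.
Proof.
elim: m => [|m IH] /andP[x0 xm]; first by move: (lt_le_trans x0 xm); rewrite ltxx.
have [xm'|xm'] := leP x m%:R.
  by have [|j jm jx] := IH; [rewrite x0|exists j => //; exact: ltnW].
by exists m => //; rewrite subr_gt0 xm' lerBlDl natr1.
Qed.

Lemma rotate_polar z : z != 0 -> exists j r t,
  [/\ (j < n)%N, 0 < r, - a <= t < a & zeta ^+ j * z = r%:C * expi t].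
Proof.
move=> z0; have [r [t0 [r0 /andP[t1 t2] zE]]] := polarP z0.
(* The angle is first moved into [a - 2 pi, a[, so that fewer than n rotations, all forward, reach
   [-a, a[. *)
have [t [tE /andP[t3 t4]]] : exists t, expi t = expi t0 /\ a - 2 * pi <= t < a.
  have [t0a|t0a] := ltP t0 a.
    by exists t0; rewrite t0a andbT; split => //; have := a_le; have := pi_gt0 R; lra.
  exists (t0 - 2 * pi); split; last by have := pi_gt0 R; have := a_gt0; lra.
  have p2 : expi (- (2 * pi)) = 1.
    by rewrite /expi cosN sinN mulr_natl mulr2n cosDpi sinDpi cospi sinpi opprK !oppr0.
  by rewrite expiD p2 mulr1.
have a2 : 0 < 2 * a by rewrite pmulr_rgt0.
have [|j jn /andP[j1 j2]] := @nat_ceil n ((a - t) / (2 * a)).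
  rewrite divr_gt0 ?subr_gt0//=.
  by rewrite ler_pdivrMr// mulrCA naE; lra.
exists j, r, (t + j%:R * (2 * a)); split => //.
  move: j1 j2; rewrite subr_gt0 ltr_pdivlMr// lerBlDr ler_pdivrMr//; nra.
by rewrite zE -tE zetaX expiD; ring.
Qed.

Lemma maxRe_attained z : exists2 w, w ^+ n = 1 & Re (w * z) = maxRe z.
Proof.
have [->|z0] := eqVneq z 0.
  by exists 1; rewrite ?expr1n// mulr0 maxRe0.
have [j [r [t [_ r0 /andP[t1 t2] E]]]] := rotate_polar z0.
have u1 : (zeta ^+ j) ^+ n = 1 by rewrite -exprM mulnC exprM zeta_unity expr1n.
exists (zeta ^+ j) => //; rewrite -(maxRe_root z u1) E Re_polar.
by rewrite maxRe_polar_sector// ler_norml t1 ltW.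
Qed.

(* The half-open sector of angles -a <= t < a, without the origin; for n = 2 it
   also omits the ray t = -a. *)
Definition sector z : bool :=
  (Im z * cos a < Re z * sin a) && (- (Re z * sin a) <= Im z * cos a).

Lemma sector_polar r t : 0 < r ->
  sector (r%:C * expi t) = (sin (t - a) < 0) && (0 <= sin (t + a)).
Proof.
move=> r0; rewrite /sector Re_polar Im_polar -!mulrA -mulrN !ltr_pM2l// ler_pM2l//.
by rewrite sinB sinD subr_lt0; congr (_ && _); rewrite -subr_ge0 opprK.
Qed.

(** With the angle in [-pi, pi], one of the two sines of [sector_polar] has the wrong sign as soon
    as t leaves [-a, a[. *)
Lemma sectorP z : sector z ->
  exists r t, [/\ 0 < r, - a <= t < a & z = r%:C * expi t].
Proof.
move=> sz; have z0 : z != 0.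
  by apply: contraTneq sz => ->; rewrite /sector/= !mul0r ltxx.
have [r [t [r0 /andP[t1 t2] zE]]] := polarP z0.
move: sz; rewrite {1}zE sector_polar// => /andP[s1 s2].
exists r, t; split => //; have ppi := pi_gt0 R; apply/andP; split.
  rewrite leNgt; apply/negP => ta; move: s2; apply/negP; rewrite -ltNge.
  by rewrite -[t + a]opprK sinN oppr_lt0 sin_gt0_pi//; have := a_gt0; lra.
rewrite ltNge; apply/negP => ta; move: s1; apply/negP; rewrite -leNgt.
by rewrite sin_ge0_pi//; have := a_gt0; lra.
Qed.

Lemma maxRe_sector z : sector z -> maxRe z = Re z.
Proof.
move=> /sectorP[r [t [r0 /andP[t1 t2] ->]]].
by rewrite Re_polar maxRe_polar_sector// ler_norml t1 ltW.
Qed.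

(** For n = 2 the sector is the open right half-plane, whose rotates miss the imaginary axis; hence
    the hypothesis on Re z. *)
Lemma sector_cover z : Re z != 0 -> exists2 j, (j < n)%N & sector (zeta ^+ j * z).
Proof.
move=> rz0; have z0 : z != 0 by apply: contraNneq rz0 => ->.
have [j [r [t [jn r0 /andP[t1 t2] E]]]] := rotate_polar z0.
exists j => //; rewrite E sector_polar//; apply/andP; split; last first.
  by rewrite sin_ge0_pi//; have := a_le; lra.
rewrite -[t - a]opprK sinN oppr_lt0 sin_gt0_pi//.
have ppi := pi_gt0 R; have ap := a_gt0.
rewrite opprB subr_gt0 t2/= ltrBlDl.
(* The strict inequality can fail only if a - t = pi, which forces t = -a and n = 2. Then zeta = -1,
   and z would be purely imaginary. *)
rewrite lt_neqAle; apply/andP; split; last by have := a_le; lra.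
apply/eqP => atpi.
have aE : a = pi / 2 by have := a_le; lra.
have tE : t = - (pi / 2) by lra.
have nE : n = 2%N.
  apply/eqP; rewrite -(eqr_nat R); apply/eqP.
  apply: (@mulIf _ (pi / 2)); first by rewrite gt_eqF// divr_gt0.
  by rewrite -{1}aE naE; field.
move: E; rewrite tE => /(congr1 (fun z => Re z));
  rewrite Re_polar cosN cos_pihalf mulr0.
rewrite zetaX aE mulrC; have -> : 2 * (pi / 2) = pi :> R by field.
move: jn; rewrite nE; case: j => [_|[|//] _].
  by rewrite mul0r expi0 mulr1 => /eqP; rewrite (negbTE rz0).
rewrite mul1r /expi cospi sinpi; case: z rz0 {z0} => x y /= x0.
by rewrite mulr0 subr0 mulrN1 => /eqP; rewrite oppr_eq0 (negbTE x0).
Qed.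

(** If i < j, the angle d by which the two polar forms differ satisfies [expi d = 1], but the
    half-open sectors keep it strictly between 0 and 2 pi. *)
Lemma sector_uniq z i j : (i < n)%N -> (j < n)%N ->
  sector (zeta ^+ i * z) -> sector (zeta ^+ j * z) -> i = j.
Proof.
wlog ij : i j / (i < j)%N.
  move=> H iN jN si sj; have [ij|ji|//] := ltngtP i j; first exact: H.
  by apply/esym; exact: H.
move=> iN jN /sectorP[r [t [r0 /andP[t1 t2] zi]]] /sectorP[s [u [s0 /andP[u1 u2] zj]]].
have E : r%:C * expi (j%:R * (2 * a) + t) = s%:C * expi (i%:R * (2 * a) + u).
  by rewrite !expiD -!zetaX !(mulrCA _%:C) -zi -zj mulrCA.
have rs : r = s by rewrite -(modulus_polar (j%:R * (2 * a) + t) (ltW r0)) E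
  modulus_polar// ltW.
pose d := (j - i)%:R * (2 * a) + t - u.
have dE : expi d = 1.
  have r0' : r%:C != 0 by rewrite (inj_eq (@complexI R) _ 0) gt_eqF.
  move: E; rewrite -rs => /(mulfI r0') E.
  have -> : d = (j%:R * (2 * a) + t) + (- (i%:R * (2 * a) + u)).
    by rewrite /d natrB ?(ltnW ij)//; ring.
  by rewrite expiD E -expiD subrr expi0.
have ap := a_gt0.
have ji1 : 1 <= (j - i)%:R :> R by rewrite ler1n subn_gt0.
have jin : (j - i)%:R <= n%:R - 1 :> R.
  by rewrite lerBrDr natr1 ler_nat (leq_ltn_trans (leq_subr _ _)).
have d0 : 0 < d by rewrite /d; nra.
have d2 : d < 2 * pi.
  have a2 : 0 <= 2 * a by lra.
  have := ler_wpM2r a2 jin; have nE : n%:R * (2 * a) = 2 * pi by rewrite mulrCA naE.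
  by rewrite mulrBl mul1r nE /d; lra.
(* The contradiction comes from cos d = 1 - 2 sin^2 (d / 2), with d / 2 in ]0, pi[. *)
have sd : 0 < sin (d / 2) by rewrite sin_gt0_pi//; lra.
have : cos d = 1 by have := congr1 (fun z => Re z) dE.
have -> : d = d / 2 + d / 2 by lra.
rewrite cosD => cd; exfalso; move: sd cd (cos2Dsin2 (d / 2)).
move: (sin _) (cos _) => x y x0 c1; rewrite !expr2 => c2.
have /eqP : x * x = 0 by lra.
by rewrite mulf_eq0 orbb gt_eqF.
Qed.

End sectors.

(** * The lens space *)

Section complex_measurable.
Local Open Scope complex_scope.
Context {R : realType}.

Definition cmeasurable d (T : measurableType d) (f : T -> R[i]) :=
  measurable_fun setT (fun x => complex.Re (f x) : measurableTypeR R) /\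
  measurable_fun setT (fun x => complex.Im (f x) : measurableTypeR R).

Context d (T : measurableType d).
Implicit Types f g : T -> R[i].

Lemma cmeasurable_cst c : cmeasurable (fun _ : T => c).
Proof. by split. Qed.

Lemma cmeasurableD f g : cmeasurable f -> cmeasurable g ->
  cmeasurable (fun x => f x + g x).
Proof.
move=> [f1 f2] [g1 g2]; split.
  rewrite (_ : (fun _ => _) = (fun x => complex.Re (f x) + complex.Re (g x))).
    exact: measurable_funD.
  by apply/funext => x; case: (f x) (g x) => ? ? [].
rewrite (_ : (fun _ => _) = (fun x => complex.Im (f x) + complex.Im (g x))).
  exact: measurable_funD.
by apply/funext => x; case: (f x) (g x) => ? ? [].
Qed.

Lemma cmeasurableM f g : cmeasurable f -> cmeasurable g ->
  cmeasurable (fun x => f x * g x).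
Proof.
move=> [f1 f2] [g1 g2]; split.
  rewrite (_ : (fun _ => _) = (fun x => complex.Re (f x) * complex.Re (g x) -
      complex.Im (f x) * complex.Im (g x))).
    by apply: measurable_funB; apply: measurable_funM.
  by apply/funext => x; case: (f x) (g x) => ? ? [].
rewrite (_ : (fun _ => _) = (fun x => complex.Re (f x) * complex.Im (g x) +
    complex.Im (f x) * complex.Re (g x))).
  by apply: measurable_funD; apply: measurable_funM.
by apply/funext => x; case: (f x) (g x) => ? ? [].
Qed.

Lemma cmeasurable_conj f : cmeasurable f -> cmeasurable (fun x => (f x)^*).
Proof.
move=> [f1 f2]; split.
  by rewrite (_ : (fun _ => _) = (fun x => complex.Re (f x)))//;
    apply/funext => x; case: (f x).
rewrite (_ : (fun _ => _) = (fun x => - complex.Im (f x))).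
  exact: measurable_funN.
by apply/funext => x; case: (f x).
Qed.

Lemma cmeasurableX f m : cmeasurable f -> cmeasurable (fun x => f x ^+ m).
Proof.
move=> mf; elim: m => [|m IH]; first exact: cmeasurable_cst.
by under eq_fun do rewrite exprS; exact: cmeasurableM.
Qed.

Lemma cmeasurable_sum (I : Type) (s : seq I) (F : I -> T -> R[i]) :
  (forall i, cmeasurable (F i)) -> cmeasurable (fun x => \sum_(i <- s) F i x).
Proof.
move=> mF; elim: s => [|i s IH].
  by under eq_fun do rewrite big_nil; exact: cmeasurable_cst.
by under eq_fun do rewrite big_cons; exact: cmeasurableD.
Qed.

Lemma measurable_modulus f : cmeasurable f ->
  measurable_fun setT (fun x => modulus (f x) : measurableTypeR R).
Proof.
move=> [f1 f2]; apply: (measurableT_comp (continuous_measurable_fun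
  (@sqrt_continuous R))).
by apply: measurable_funD; apply: measurable_funX.
Qed.

Lemma measurable_maxRe_pow n f : cmeasurable f ->
  measurable_fun setT (fun x => maxRe_pow n (f x) : measurableTypeR R).
Proof.
move=> mf; have mm := measurable_modulus mf; have [f1 f2] := mf.
apply: measurable_funM; first exact: (measurableT_comp (measurable_powR _) mm).
apply: (measurableT_comp (continuous_measurable_fun (@continuous_cos R))).
apply: measurable_funM => //; apply: (measurableT_comp measurable_acosc).
apply: measurable_funM => //; apply: measurable_sqrtV.
by apply: measurable_funD; apply: measurable_funX.
Qed.

End complex_measurable.

Section hermitian.
Local Open Scope complex_scope.
Context {R : realType}.
Implicit Types p q : R[i] * R[i].

(** Its real part is the Euclidean inner product of R^4, and acting on a point by w multiplies it by
    w or by the conjugate of w. *)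
Definition herm p q : R[i] := p.1^* * q.1 + p.2^* * q.2.

Lemma dot4_Zn_act (w : R[i]) p q :
  dot4 (coords (Zn_act w p)) (coords q) = complex.Re (w^* * herm p q).
Proof.
case: w p q => [w1 w2] [[a1 a2] [b1 b2]] [[c1 c2] [d1 d2]].
by rewrite /dot4 /=; ring.
Qed.

Lemma herm_Zn_act (w : R[i]) p q : herm p (Zn_act w q) = w * herm p q.
Proof. by rewrite /herm /=; ring. Qed.

Lemma dot4_unit_bound (p q : R[i] * R[i]) : on_sphere3 p -> on_sphere3 q ->
  -1 <= dot4 (coords p) (coords q) <= 1.
Proof.
rewrite !on_sphere3E /dot4/= => /eqP hp /eqP hq.
move: (complex.Re p.1) (complex.Im p.1) (complex.Re p.2) (complex.Im p.2) hp =>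
  a b c e hp.
move: (complex.Re q.1) (complex.Im q.1) (complex.Re q.2) (complex.Im q.2) hq =>
  a' b' c' e' hq.
(* Cauchy-Schwarz for unit vectors, by expanding |p - q|^2 and |p + q|^2. *)
have h1 : 0 <= (a - a') ^+ 2 + (b - b') ^+ 2 + (c - c') ^+ 2 + (e - e') ^+ 2.
  by rewrite !addr_ge0// sqr_ge0.
have h2 : 0 <= (a + a') ^+ 2 + (b + b') ^+ 2 + (c + c') ^+ 2 + (e + e') ^+ 2.
  by rewrite !addr_ge0// sqr_ge0.
by apply/andP; split; nra.
Qed.

Lemma Zn_norm n (w : R[i]) : (0 < n)%N -> w ^+ n = 1 -> `|w| = 1.
Proof.
move=> n0 wn; have /eqP : `|w| ^+ n = 1 by rewrite -normrX wn normr1.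
by rewrite pexpr_eq1// => /eqP.
Qed.

Lemma on_sphere3_Zn_act n (w : R[i]) p : (0 < n)%N -> w ^+ n = 1 ->
  on_sphere3 p -> on_sphere3 (Zn_act w p).
Proof.
by move=> n0 wn; rewrite /on_sphere3/= !normrM (Zn_norm n0 wn) !mul1r.
Qed.

End hermitian.

Section lens_distance.
Local Open Scope complex_scope.
Context {R : realType} (n : nat) (n2 : (2 <= n)%N).

Let n0 : (0 < n)%N. Proof. exact: leq_trans n2. Qed.

(** Since [acosc] is nonincreasing, the least distance comes from the largest inner product;
    conjugation permutes the nth roots of unity, so the conjugate on w is harmless. *)
Lemma lens_distE (x y : lens R n) :
  lens_dist x y = acosc (maxRe n (herm (sphere3_val (repr x)) (sphere3_val (repr y)))).
Proof.
set p := repr x; set q := repr y; rewrite /lens_dist -/p -/q.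
have dE w : w ^+ n = 1 ->
    dist_sphere3 (Zn_act w p) q = acosc (complex.Re (w^* * herm p q)).
  move=> w1; rewrite /dist_sphere3 -dot4_Zn_act acoscE//.
  apply: dot4_unit_bound; last exact: sphere3P.
  by apply: (on_sphere3_Zn_act n0 w1); exact: sphere3P.
have conj1 (w : R[i]) : w ^+ n = 1 -> w^* ^+ n = 1.
  by move=> w1; rewrite -rmorphXn w1 rmorph1.
set S := [set _ | _ in _].
have lb : lbound S (acosc (maxRe n (herm p q))).
  move=> _ [w w1 <-]; rewrite dE//; apply: acosc_nonincreasing.
  rewrite -(maxRe_root (herm p q) (conj1 _ w1)).
  exact: Re_le_maxRe.
have Sm : S (acosc (maxRe n (herm p q))).
  have [w w1 wE] := maxRe_attained n2 (herm p q).
  by exists w^*; [exact: conj1|rewrite dE ?conj1// conjCK wE].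
apply/eqP; rewrite eq_le; apply/andP; split.
  by apply: ge_inf => //; exists (acosc (maxRe n (herm p q))).
by apply: lb_le_inf => //; exists (acosc (maxRe n (herm p q))).
Qed.

(** [repr] chooses an arbitrary point of the orbit; whatever is computed from it has to be invariant
    under this unknown w. *)
Lemma repr_lens_proj (q : sphere3 R) :
  exists2 w, w ^+ n = 1 & sphere3_val (repr (lens_proj n q)) = Zn_act w q.
Proof.
have : lens_equiv R n q (repr (lens_proj n q)).
  by apply/eqmodP; rewrite /lens_proj reprK.
by move=> /asboolP[w w1 <-]; exists w.
Qed.

Lemma lens_dist_proj (x : lens R n) (q : sphere3 R) :
  lens_dist x (lens_proj n q) =
  acosc (maxRe n (herm (sphere3_val (repr x)) (sphere3_val q))).
Proof.
rewrite lens_distE; have [w w1 ->] := repr_lens_proj q.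
by rewrite herm_Zn_act maxRe_root.
Qed.

Lemma measurable_lens d (T : measurableType d) (g : lens R n -> T) :
  measurable_fun setT (g \o @lens_proj R n) -> measurable_fun setT g.
Proof.
by move=> mg _ B mB; rewrite setTI; exact: mg measurableT B mB.
Qed.

(* These monomials are Z_n-invariant, hence measurable on the quotient; the n-th
   power of the Hermitian product expands in them. *)
Lemma cmeasurable_monomial j : (j <= n)%N ->
  cmeasurable (fun x : lens R n =>
    (sphere3_val (repr x)).1 ^+ (n - j) * (sphere3_val (repr x)).2 ^+ j).
Proof.
move=> jn.
pose F (q : sphere3 R) := (sphere3_val q).1 ^+ (n - j) * (sphere3_val q).2 ^+ j.
have mF : cmeasurable F.
  have mc : measurable_fun setT (@sphere3_coords R).
    by move=> _ B mB; exists B.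
  have m1 := measurableT_comp measurable_fst mc.
  have m2 := measurableT_comp measurable_snd mc.
  apply: cmeasurableM; apply: cmeasurableX; split.
  - exact: (measurableT_comp measurable_fst m1).
  - exact: (measurableT_comp measurable_snd m1).
  - exact: (measurableT_comp measurable_fst m2).
  - exact: (measurableT_comp measurable_snd m2).
have FE q : F (repr (lens_proj n q)) = F q.
  rewrite /F; have [w w1 ->] := repr_lens_proj q; rewrite /= !exprMn.
  by rewrite mulrACA -exprD subnK// w1 mul1r.
case: mF => F1 F2; split; apply: measurable_lens.
  by rewrite (_ : _ \o _ = fun q => complex.Re (F q))//; apply/funext => q /=;
    rewrite -FE.
by rewrite (_ : _ \o _ = fun q => complex.Im (F q))//; apply/funext => q /=;
  rewrite -FE.
Qed.

(** [measurable_lens] pulls back one variable at a time, while the domain carries a product of two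
    quotient sigma-algebras. The binomial expansion of [herm] to the power n separates the
    variables: each term is a product of an invariant monomial in x, conjugated, and one in y. *)
Lemma measurable_lens_dist :
  measurable_fun setT (fun z : lens R n * lens R n =>
    lens_dist z.1 z.2 : measurableTypeR R).
Proof.
under eq_fun do rewrite lens_distE.
apply: (measurableT_comp measurable_acosc); apply: measurable_maxRe_pow.
under eq_fun do rewrite exprDn.
apply: cmeasurable_sum => j.
have jn : (j <= n)%N by rewrite -ltnS.
have [m1 m2] := cmeasurable_monomial jn.
pose M (x : lens R n) :=
  (sphere3_val (repr x)).1 ^+ (n - j) * (sphere3_val (repr x)).2 ^+ j.
rewrite (_ : (fun _ => _) = fun z => 'C(n, j)%:R * ((M z.1)^* * M z.2)); last first.
  apply/funext => z; rewrite -mulr_natl; congr (_ * _).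
  by rewrite /M (rmorphM (@conjc R)) !(rmorphXn (@conjc R)) !exprMn mulrACA.
apply: cmeasurableM; first exact: cmeasurable_cst.
apply: cmeasurableM.
  apply: cmeasurable_conj; split.
    exact: (measurableT_comp m1 measurable_fst).
  exact: (measurableT_comp m2 measurable_fst).
split.
  exact: (measurableT_comp m1 measurable_snd).
exact: (measurableT_comp m2 measurable_snd).
Qed.

End lens_distance.

(** * Integration over the sphere and the lens space *)

Section lens_integral.
Local Open Scope complex_scope.
Context {R : realType}.
Local Notation mR := (measurableTypeR R).
Local Notation R2 := (mR * mR)%type.
Local Notation R4 := (R2 * R2)%type.
Local Open Scope ereal_scope.

Lemma lebesgue4_axis : @lebesgue4 R [set v | v.1.1 = 0]%R = 0.
Proof.
have -> : [set v : R4 | v.1.1 = 0]%R = ([set (0%R : mR)] `*` setT) `*` setT.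
  by apply/seteqP; split => [[[x y] w]|[[x y] w] [[]]].
have m2 : measurable ([set (0%R : mR)] `*` (setT : set mR)) by exact: measurableX.
rewrite /lebesgue4 product_measure1E// [X in X * _](_ : _ = 0) ?mul0e//.
rewrite /= /lebesgue2 product_measure1E//= [X in X * _](_ : _ = 0) ?mul0e//.
exact: lebesgue_measure_set1.
Qed.

Lemma measurable_axisC : measurable_fun setT (fun v : R4 => v.1.1 != 0%R).
Proof.
apply: measurable_neg; apply: measurable_fun_eqr => //.
by apply: measurableT_comp => //; exact: measurable_fst.
Qed.

(** The discarded null hyperplane contains the origin, where [radial] takes its default value, and
    the points that no rotate of the sector covers when n = 2. *)
Lemma ge0_integral_off_axis (f : R4 -> \bar R) :
  measurable_fun setT f -> (forall v, 0 <= f v) ->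
  \int[@lebesgue4 R]_v f v =
  \int[@lebesgue4 R]_v (if v.1.1 != 0%R then f v else 0).
Proof.
move=> mf f0; rewrite -integral_if.
have mN : measurable [set v : R4 | v.1.1 = 0%R].
  rewrite (_ : [set v : R4 | v.1.1 = 0%R] = ~` [set v : R4 | v.1.1 != 0%R]).
    by apply: measurableC; apply: measurable_setb; exact: measurable_axisC.
  by apply/seteqP; split => v /=; [move=> ->; rewrite eqxx|move=> /negP/negPn/eqP].
rewrite (@ge0_negligible_integral _ _ _ _ setT _ _ mN)//; last exact: lebesgue4_axis.
congr (integral _ _ _); apply/seteqP; split => v /=.
  by move=> [_ /eqP].
by move=> /eqP.
Qed.

(** The case psi = 1 of [ge0_integral_ball4]; it amounts to pi^2 / 2. *)
Lemma ball4_volume : @lebesgue4 R (@ball4 R) = disk_area * (2^-1%R)%:E * @disk_area R.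
Proof.
rewrite -[RHS]/(_ * (@lebesgue2 R [set z | norm2 z < 1]%R)).
rewrite -[in RHS](mul1e (lebesgue2 _)) -integral_cst; last exact: measurable_norm2_lt.
rewrite -(@ge0_integral_ball4 _ (cst 1))// integral_cst ?mul1e//.
exact: measurable_ball4.
Qed.

Lemma ball4_volume_gt0 : 0 < @lebesgue4 R (@ball4 R).
Proof. by rewrite ball4_volume !mule_gt0 ?disk_area_gt0// lte_fin invr_gt0. Qed.

Lemma ball4_volume_fin_num : @lebesgue4 R (@ball4 R) \is a fin_num.
Proof. by rewrite ball4_volume !fin_numM ?disk_area_fin_num. Qed.

Local Notation V := (fine (@lebesgue4 R (@ball4 R))).

Lemma ge0_integral_sphere3_unif (g : sphere3 R -> \bar R) :
  measurable_fun setT g -> (forall p, 0 <= g p) ->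
  \int[@sphere3_unif R]_p g p =
  (V^-1)%:E * \int[@lebesgue4 R]_(v in @ball4 R) g (radial v).
Proof.
move=> mg g0.
have mgr : measurable_fun setT (g \o @radial R).
  exact: (measurableT_comp mg (@measurable_radial R)).
rewrite /sphere3_unif ge0_integral_distribution//.
have Vi : (0 <= V^-1)%R by rewrite invr_ge0 fine_ge0// ltW// ball4_volume_gt0.
rewrite -(ge0_integral_mrestr _ (@measurable_ball4 R) mgr); last by move=> v; exact: g0.
rewrite -[(V^-1)%:E]/((NngNum Vi)%:num%:E) -ge0_integral_mscale//;
  last by move=> v _; exact: g0.
apply: eq_measure_integral => A mA _.
rewrite /= /mscale/= /mnormalize/= /mrestr setTI.
(* The volume is neither 0 nor +oo, so [mnormalize] takes its main branch. *)
by rewrite gt_eqF ?ball4_volume_gt0//= lt_eqF ?ltey_eq ?ball4_volume_fin_num//= muleC.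
Qed.

Lemma ge0_integral_lens_unif n (g : lens R n -> \bar R) :
  measurable_fun setT g -> (forall x, 0 <= g x) ->
  \int[@lens_unif R n]_x g x =
  (V^-1)%:E * \int[@lebesgue4 R]_(v in @ball4 R) g (lens_proj n (radial v)).
Proof.
move=> mg g0; rewrite /lens_unif ge0_integral_distribution//.
rewrite ge0_integral_sphere3_unif//; last by move=> p; exact: g0.
exact: (measurableT_comp mg (@measurable_lens_proj R n)).
Qed.

End lens_integral.

Section special_unitary.
Local Open Scope complex_scope.
Context {R : realType}.
Local Notation mR := (measurableTypeR R).
Local Notation R2 := (mR * mR)%type.
Local Notation R4 := (R2 * R2)%type.
Implicit Types (a b : R[i]) (v : R4).

(** Under [su2_cond a b] this is the general element of SU(2). *)
Definition su2 a b : R4 -> R4 := mat2 a b (- b^*) a^*.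

Definition su2_cond a b :=
  complex.Re a ^+ 2 + complex.Im a ^+ 2 + (complex.Re b ^+ 2 + complex.Im b ^+ 2) = 1.

Lemma dot4_su2 a b v : su2_cond a b -> dot4 (su2 a b v) (su2 a b v) = dot4 v v.
Proof.
move=> ab; rewrite -[RHS]mul1r -ab.
case: a b v {ab} => [a1 a2] [b1 b2] [[x y] [z w]].
by rewrite /dot4 /su2 /mat2 /addp /mulp /=; ring.
Qed.

Lemma preserving_su2 a b : su2_cond a b -> preserving4 (su2 a b).
Proof.
move=> ab; apply: preserving_sl2; case: a b ab => [a1 a2] [b1 b2] /= ab.
apply/eqP; rewrite eq_complex/=; apply/andP; split; apply/eqP; last by ring.
by rewrite -[RHS]ab/=; ring.
Qed.

Lemma ge0_integral_ball4_su2 a b (f : R4 -> \bar R) : su2_cond a b ->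
  measurable_fun setT f -> (forall v, (0 <= f v)%E) ->
  (\int[@lebesgue4 R]_(v in @ball4 R) f (su2 a b v) =
   \int[@lebesgue4 R]_(v in @ball4 R) f v)%E.
Proof.
move=> ab mf f0; rewrite [LHS]integral_if [RHS]integral_if.
rewrite -(preserving_su2 ab (f := fun v => if dot4 v v <= 1 then f v else 0%E)).
- by apply: eq_integral => v _; rewrite dot4_su2.
- apply: measurable_fun_ifT => //; apply: measurable_fun_ler => //.
  exact: measurable_dot4.
- by move=> v; case: ifP.
Qed.

(** The second coordinate turns the opposite way to keep the determinant equal to 1; [proj4] does
    not see it. *)
Lemma proj4_rotation t v : proj4 (su2 (expi t) 0 v) = mulp (expi t) (proj4 v).
Proof.
have ab : su2_cond (expi t) 0 by rewrite /su2_cond/= expr0n !addr0 cos2Dsin2.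
rewrite /proj4 dot4_su2//; move: (Num.sqrt _)^-1 => r.
case: v => [[x y] [z w]]; rewrite /su2 /mat2 /addp /mulp/=.
by congr (_, _); ring.
Qed.

Lemma su2_cond_conj (p : sphere3 R) :
  su2_cond (sphere3_val p).1^* (sphere3_val p).2^*.
Proof.
have := sphere3P p; rewrite on_sphere3E /dot4/= => /eqP.
by rewrite /su2_cond; case: (sphere3_val p) => [[a1 a2] [b1 b2]] /= <-; ring.
Qed.

(** The first row of this unitary matrix consists of the conjugate coordinates of p, so the matrix
    takes p to (1, 0), and the first coordinate of the image of v is the Hermitian product of p with
    v. *)
Lemma herm_radial (p : sphere3 R) v : v.1.1 != 0 ->
  herm (sphere3_val p) (sphere3_val (radial v)) =
  toC (proj4 (su2 (sphere3_val p).1^* (sphere3_val p).2^* v)).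
Proof.
move=> v0; have d0 : 0 < dot4 v v.
  by rewrite /dot4 ltr_pwDl// ?ltr_pwDl// -?expr2 ?addr_ge0 ?sqr_ge0// lt_neqAle
    sqr_ge0 eq_sym sqrf_eq0 v0.
have s0 : 0 < Num.sqrt (dot4 v v) by rewrite sqrtr_gt0.
have uv : on_sphere3 (unit4 v).
  rewrite on_sphere3E; apply/eqP; rewrite {1}/dot4/=.
  have r2 := sqr_sqrtr (ltW d0); move: (Num.sqrt (dot4 v v)) r2 s0 => r r2 r0.
  transitivity (dot4 v v / r ^+ 2); last by rewrite r2 divff// gt_eqF.
  by rewrite /dot4; field; rewrite gt_eqF.
rewrite /radial val_insubd uv /proj4 dot4_su2; last exact: su2_cond_conj.
rewrite /unit4; move: (Num.sqrt (dot4 v v)) s0 => r r0; apply/eqP.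
case: v (sphere3_val p) {v0 d0 uv} => [[x y] [z w]] [[a1 a2] [b1 b2]].
rewrite eq_complex/= /toC/= /herm/=.
by apply/andP; split; apply/eqP; field; rewrite gt_eqF.
Qed.

End special_unitary.

Section lens_moment.
Local Open Scope complex_scope.
Context {R : realType} (n : nat) (n2 : (2 <= n)%N) (k : nat).
Local Notation mR := (measurableTypeR R).
Local Notation R2 := (mR * mR)%type.
Local Notation R4 := (R2 * R2)%type.
Local Open Scope ereal_scope.

Definition dist_pow (z : R2) : \bar R := (acosc (maxRe n (toC z)) ^+ k)%:E.

(** On the sector [maxRe n (toC z)] is z.1, so this is [dist_pow] cut off outside it. *)
Definition sector_pow (z : R2) : \bar R :=
  if sector n (toC z) then (acosc z.1 ^+ k)%:E else 0.

Lemma dist_pow_ge0 z : 0 <= dist_pow z.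
Proof. by rewrite lee_fin exprn_ge0// acosc_ge0. Qed.

Lemma sector_pow_ge0 z : 0 <= sector_pow z.
Proof. by rewrite /sector_pow; case: ifP; rewrite ?lee_fin ?exprn_ge0 ?acosc_ge0. Qed.

Lemma measurable_dist_pow : measurable_fun setT dist_pow.
Proof.
apply/measurable_EFinP; apply: measurable_funX.
apply: (measurableT_comp measurable_acosc); apply: measurable_maxRe_pow.
by apply: cmeasurableX; split; [exact: measurable_fst|exact: measurable_snd].
Qed.

Lemma measurable_sector_pow : measurable_fun setT sector_pow.
Proof.
apply: measurable_fun_ifT => //.
  apply: measurable_and; [apply: measurable_fun_ltr|apply: measurable_fun_ler];
    rewrite /=; (try apply: measurable_funN); apply: measurable_funM => //.
apply/measurable_EFinP; apply: measurable_funX.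
exact: (measurableT_comp measurable_acosc measurable_fst).
Qed.

Lemma measurable_proj4 : measurable_fun setT (@proj4 R).
Proof.
have md := measurable_sqrtV (@measurable_dot4 R).
by apply: measurable_fun_pair; apply: measurable_funM => //;
  apply: measurableT_comp => //; exact: measurable_fst.
Qed.

Definition sector_integral : \bar R :=
  \int[@lebesgue2 R]_(z in [set z | norm2 z < 1]%R) sector_pow z.

Lemma integral_ball4_dist_pow :
  \int[@lebesgue4 R]_(v in @ball4 R) dist_pow (proj4 v) =
  n%:R%:E * \int[@lebesgue4 R]_(v in @ball4 R) sector_pow (proj4 v).
Proof.
have mball : measurable_fun setT (fun v : R4 => dot4 v v <= 1)%R.
  by apply: measurable_fun_ler => //; exact: measurable_dot4.
pose rot (j : nat) := su2 (expi (j%:R * (2 * (pi / n%:R))) : R[i]) 0%R.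
have rotE (j : nat) v : proj4 (rot j v) = mulp (zeta n ^+ j)%R (proj4 v).
  by rewrite proj4_rotation zetaX.
have mrot j : measurable_fun setT (rot j) by exact: measurable_mat2.
have mp := measurableT_comp measurable_sector_pow measurable_proj4.
(* [sector_cover] provides one rotate in the sector, and [sector_uniq] makes all other summands
   vanish. *)
have key v : v.1.1 != 0%R ->
    dist_pow (proj4 v) = \sum_(j < n) sector_pow (proj4 (rot j v)).
  move=> v0; set z := proj4 v.
  have z0 : (complex.Re (toC z) != 0)%R.
    rewrite /= mulf_neq0// invr_eq0 gt_eqF// sqrtr_gt0.
    by rewrite /dot4 ltr_pwDl// ?ltr_pwDl// -?expr2 ?addr_ge0 ?sqr_ge0//
      lt_neqAle sqr_ge0 eq_sym sqrf_eq0 v0.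
  have [j jn sj] := sector_cover n2 z0.
  rewrite (bigD1 (Ordinal jn))//= big1 ?adde0.
    rewrite rotE /sector_pow toC_mulp sj /dist_pow.
    rewrite -(maxRe_root (toC z) (w := zeta n ^+ j)%R); last first.
      by rewrite -exprM mulnC exprM zeta_unity// expr1n.
    by rewrite maxRe_sector// -toC_mulp.
  move=> i ij; rewrite rotE /sector_pow toC_mulp; case: ifPn => // si.
  by move: ij; rewrite -val_eqE/= (sector_uniq n2 (ltn_ord i) jn si sj) eqxx.
rewrite [LHS]integral_if ge0_integral_off_axis; last 2 first.
- apply: measurable_fun_ifT => //.
  exact: (measurableT_comp measurable_dist_pow measurable_proj4).
- by move=> v; case: ifP => // _; exact: dist_pow_ge0.
transitivity (\int[@lebesgue4 R]_v (if (dot4 v v <= 1)%R then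
    \sum_(j < n) sector_pow (proj4 (rot j v)) else 0)).
  rewrite [RHS]ge0_integral_off_axis; last 2 first.
  - apply: measurable_fun_ifT => //; apply: emeasurable_sum => j.
    exact: (measurableT_comp mp (mrot j)).
  - move=> v; case: ifP => // _; apply: sume_ge0 => j _; exact: sector_pow_ge0.
  by apply: eq_integral => v _; case: ifPn => // v0; rewrite key.
rewrite -integral_if ge0_integral_sum//; last 3 first.
- exact: measurable_ball4.
- move=> j; apply: measurable_funTS; exact: (measurableT_comp mp (mrot j)).
- by move=> j v _; exact: sector_pow_ge0.
under eq_bigr => j _.
  rewrite (@ge0_integral_ball4_su2 _ _ _ (sector_pow \o @proj4 R))//; last 2 first.
    by rewrite /su2_cond/= expr0n !addr0 cos2Dsin2.
    by move=> v; exact: sector_pow_ge0.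
  over.
by rewrite sumr_const card_ord mule_natl.
Qed.

Lemma integral_lens_dist_pow (x : lens R n) :
  \int[@lens_unif R n]_y (lens_dist x y ^+ k)%:E =
  (n%:R / fine (@disk_area R))%:E * sector_integral.
Proof.
have md : measurable_fun setT (fun y => (lens_dist x y ^+ k)%:E).
  apply/measurable_EFinP; apply: measurable_funX.
  have mx : measurable_fun setT (fun y : lens R n => (x, y)).
    exact: measurable_fun_pair.
  exact: (measurableT_comp (@measurable_lens_dist R n n2) mx).
have mball : measurable_fun setT (fun v : R4 => dot4 v v <= 1)%R.
  by apply: measurable_fun_ler => //; exact: measurable_dot4.
have ld0 y : 0 <= (lens_dist x y ^+ k)%:E.
  by rewrite lens_distE// lee_fin exprn_ge0// acosc_ge0.
rewrite ge0_integral_lens_unif//.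
pose p := repr x; pose U := su2 (sphere3_val p).1^* (sphere3_val p).2^*.
have ab := su2_cond_conj p.
have mp := measurableT_comp measurable_dist_pow measurable_proj4.
have mU : measurable_fun setT U by exact: measurable_mat2.
have mpU := measurableT_comp mp mU.
have -> : \int[@lebesgue4 R]_(v in @ball4 R) (lens_dist x (lens_proj n (radial
  v)) ^+ k)%:E =
    \int[@lebesgue4 R]_(v in @ball4 R) (dist_pow \o @proj4 R) v.
  rewrite -(ge0_integral_ball4_su2 ab mp); last by move=> v; exact: dist_pow_ge0.
  rewrite [LHS]integral_if [RHS]integral_if.
  rewrite [LHS]ge0_integral_off_axis; last 2 first.
  - apply: (measurable_fun_ifT mball _ (measurable_cst 0)).
    apply: (measurableT_comp (measurableT_comp md (@measurable_lens_proj R n))).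
    exact: measurable_radial.
  - by move=> v; case: (dot4 v v <= 1)%R; [exact: ld0|exact: lexx].
  rewrite [RHS]ge0_integral_off_axis; last 2 first.
  - exact: (measurable_fun_ifT mball mpU (measurable_cst 0)).
  - by move=> v; case: (dot4 v v <= 1)%R; [exact: dist_pow_ge0|exact: lexx].
  apply: eq_integral => v _; case: ifPn => // v0; case: ifPn => // _.
  by congr ((_ ^+ k)%:E); rewrite (lens_dist_proj n2) (herm_radial (repr x) v0).
rewrite integral_ball4_dist_pow ge0_integral_ball4//; last 2 first.
- exact: measurable_sector_pow.
- exact: sector_pow_ge0.
(* The volume being half the square of the disk area, the factor 1 / 2 and one disk area cancel. *)
rewrite -/sector_integral ball4_volume -(fineK (@disk_area_fin_num R)) !muleA -!EFinM/=.
congr (_%:E * _); field.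
by rewrite gt_eqF// -lte_fin fineK ?disk_area_fin_num ?disk_area_gt0.
Qed.

Lemma lens_momentE :
  lens_moment R n k = (n%:R / fine (@disk_area R))%:E * sector_integral.
Proof.
rewrite /lens_moment unlock.
have mf : measurable_fun setT (fun z : lens R n * lens R n =>
    (lens_dist z.1 z.2 ^+ k)%:E).
  apply/measurable_EFinP; apply: measurable_funX; exact: measurable_lens_dist.
rewrite (fubini_tonelli1 _ mf); last first.
  by move=> z; rewrite lens_distE// lee_fin exprn_ge0// acosc_ge0.
rewrite (eq_integral (cst ((n%:R / fine (@disk_area R))%:E * sector_integral))).
  rewrite integral_cst// [X in _ * X](_ : _ = 1) ?mule1//.
  exact: (@probability_setT _ _ _ (@lens_unif R n)).
by move=> x _; exact: integral_lens_dist_pow.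
Qed.

End lens_moment.

(** * Slicing the sector *)

Section arccos_substitution.
Local Open Scope complex_scope.
Context {R : realType}.
Local Notation mu := (@lebesgue_measure R).

(** A decreasing map of [-1, 1] onto [0, pi] has no jumps; this covers the endpoints, where arccos
    is not differentiable. *)
Lemma continuous_acosc : {within `[-1, 1], continuous (@acosc R)}.
Proof.
have N11 : (-1 : R) <= 1 by lra.
apply: segment_dec_surj_continuous.
  move=> x y; rewrite !in_itv/= => x1 y1.
  rewrite leNgt -ltr_cos ?in_itv/= ?acosc_ge0 ?acosc_lepi//.
  by rewrite !acoscE// !acosK ?in_itv// -leNgt.
move=> t; rewrite /= in_itv/= !acoscE ?lexx ?N11// acos1 acosN1 => t01.
exists (cos t); first by rewrite /= in_itv/= cos_geN1 cos_le1.
by rewrite acosc_cos ger0_norm//; case/andP: t01.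
Qed.

Lemma withinM (A : set R) (f g : R -> R) :
  {within A, continuous f} -> {within A, continuous g} ->
  {within A, continuous (fun x => f x * g x)}.
Proof. by move=> cf cg z; apply: cvgM; [exact: cf|exact: cg]. Qed.

Lemma integral_cos_substitution (G : R -> R) (a b : R) : 0 <= a -> a <= b -> b <= pi ->
  {within `[cos b, cos a], continuous G} ->
  (\int[mu]_(x in `[cos b, cos a]) (G x)%:E =
   \int[mu]_(t in `[a, b]) (G (cos t) * sin t)%:E)%E.
Proof.
move=> a0 ab bpi cG.
have cosE : derive1 (@cos R) = (fun x => - sin x).
  by apply/funext => x; rewrite derive1E derive_val.
rewrite integration_by_substitution_decreasing//.
- by apply: eq_integral => t _; rewrite cosE /= opprK.
- move=> x y; rewrite !in_itv/= => /andP[x1 x2] /andP[y1 y2] xy.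
  by rewrite ltr_cos// in_itv/=; apply/andP; split; lra.
- by rewrite cosE => x _; apply: continuousN; exact: continuous_sin.
- rewrite cosE; apply/cvg_ex; exists (- sin a); apply: cvg_at_right_filter.
  by apply: continuousN; exact: continuous_sin.
- rewrite cosE; apply/cvg_ex; exists (- sin b); apply: cvg_at_left_filter.
  by apply: continuousN; exact: continuous_sin.
- split => //.
  + by apply: cvg_at_right_filter; exact: continuous_cos.
  + by apply: cvg_at_left_filter; exact: continuous_cos.
Qed.

End arccos_substitution.

Section sector_slices.
Local Open Scope complex_scope.
Context {R : realType} (n : nat) (n2 : (2 <= n)%N) (k : nat).
Local Notation mR := (measurableTypeR R).
Local Notation mu := (@lebesgue_measure R).
Local Notation a := (pi / n%:R : R).

Let n0 : 0 < n%:R :> R. Proof. by rewrite ltr0n (leq_trans _ n2). Qed.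

Let a_gt0 : 0 < a. Proof. by rewrite divr_gt0// pi_gt0. Qed.

Let a_le : a <= pi / 2.
Proof. by rewrite ler_pM2l ?pi_gt0// lef_pV2 ?posrE// ler_nat. Qed.

Let sin_a : 0 < sin a.
Proof. by rewrite sin_gt0_pi// a_gt0/=; have := pi_gt0 R; have := a_le; lra. Qed.

Let cos_a : 0 <= cos a.
Proof. by rewrite cos_ge0_pihalf// a_le andbT; have := a_gt0; have := pi_gt0 R;
  lra. Qed.

Definition slice (x y : R) : bool := (x ^+ 2 + y ^+ 2 < 1) && sector n (x +i* y).

Lemma slice_out x y : ~~ (0 < x < 1) -> slice x y = false.
Proof.
apply: contraNF => /andP[xy1 /andP[/= s1 s2]]; apply/andP; split.
  by rewrite -(pmulr_lgt0 _ sin_a); lra.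
by rewrite ltNge; apply/negP => x1; have := sqr_ge0 y; nra.
Qed.

(** To the right of cos a the vertical line is cut off by the circle, to the left by the two rays y
    = x tan a and y = - x tan a. *)
Lemma lebesgue_measure_slice (x : R) : 0 < x < 1 ->
  mu [set y | slice x y] =
  (if cos a <= x then 2 * Num.sqrt (1 - x ^+ 2) else 2 * x * tan a)%:E.
Proof.
move=> /andP[x0 x1]; have cs := cos2Dsin2 a; case: ifPn => cx.
  pose s := Num.sqrt (1 - x ^+ 2).
  have s0 : 0 < s by rewrite sqrtr_gt0; nra.
  have s2 : s ^+ 2 = 1 - x ^+ 2 by rewrite sqr_sqrtr//; nra.
  rewrite (_ : [set y | slice x y] = `]- s, s[%classic); last first.
    apply/seteqP; split => y /=; rewrite in_itv/=.
      by move=> /andP[xy _]; apply/andP; split; nra.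
    move=> /andP[y1 y2].
    have ys : y ^+ 2 < s ^+ 2 by nra.
    have yc : (y * cos a) ^+ 2 < (x * sin a) ^+ 2.
      rewrite !exprMn.
      have c2 : cos a ^+ 2 <= x ^+ 2 by rewrite ler_sqr// ?nnegrE// ltW.
      have e : x ^+ 2 * sin a ^+ 2 - s ^+ 2 * cos a ^+ 2 = x ^+ 2 - cos a ^+ 2.
        have -> : sin a ^+ 2 = 1 - cos a ^+ 2 by lra.
        by rewrite s2; ring.
      (* The case n = 2, where the sector condition reduces to x > 0. *)
      have [c0|c0] := eqVneq (cos a) 0.
        by rewrite c0 expr0n mulr0 mulr_gt0// exprn_gt0.
      have c3 : 0 < cos a ^+ 2 by rewrite exprn_even_gt0.
      nra.
    have xs : 0 < x * sin a by rewrite mulr_gt0.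
    rewrite /slice; apply/andP; split; first by lra.
    by rewrite /sector/=; apply/andP; split; nra.
  by rewrite lebesgue_measure_itv/= lte_fin -EFinB opprK gtrN// -mulr2n mulr_natl.
have ca : 0 < cos a by rewrite -ltNge in cx; exact: lt_trans x0 cx.
rewrite -ltNge in cx.
have tE : tan a * cos a = sin a by rewrite divfK// gt_eqF.
have t0 : 0 < tan a by rewrite divr_gt0.
rewrite (_ : [set y | slice x y] = `[- (x * tan a), x * tan a[%classic); last first.
  have e : slice x =1 (fun y => - (x * tan a) <= y < x * tan a).
    move=> y; rewrite /slice /sector/= -tE (mulrA x (tan a) (cos a)) -mulNr
      ltr_pM2r// ler_pM2r//.
    (* Between the rays the disk condition is automatic: x^2 + y^2 <= x^2 (1 + tan^2 a) = x^2 /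
       cos^2 a < 1. *)
    rewrite [X in _ && X]andbC; apply: andb_idl => /andP[y1 y2].
    have yx : y ^+ 2 <= (x * tan a) ^+ 2.
      move: y1 y2; move: (x * tan a) => u y1 y2.
      by rewrite -subr_ge0 subr_sqr mulr_ge0//; lra.
    have xx : x ^+ 2 * (1 + tan a ^+ 2) < 1.
      have -> : 1 + tan a ^+ 2 = (cos a ^+ 2)^-1.
        by rewrite -cos2_tan2// gt_eqF.
      by rewrite ltr_pdivrMr ?exprn_gt0// mul1r ltr_sqr ?nnegrE// ltW.
    by rewrite exprMn in yx; lra.
  by apply/seteqP; split => y /=; rewrite e in_itv.
rewrite lebesgue_measure_itv/= lte_fin -EFinB opprK gtrN; last exact: mulr_gt0.
by congr (_%:E); ring.
Qed.

Local Open Scope ereal_scope.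

Lemma sector_integral_slices : sector_integral n k =
  \int[mu]_x (if (0 < x < 1)%R then (acosc x ^+ k *
    (if cos a <= x then 2 * Num.sqrt (1 - x ^+ 2) else 2 * x * tan a))%:E else 0).
Proof.
rewrite /sector_integral integral_if ge0_integral_lebesgue2; last 2 first.
- apply: (measurable_fun_ifT _ (measurable_sector_pow n k) (measurable_cst 0)).
  by apply: measurable_fun_ltr => //; exact: measurable_norm2.
- by move=> z; case: ifP => // _; exact: sector_pow_ge0.
apply: eq_integral => x _.
transitivity (\int[mu]_y (if slice x y then (acosc x ^+ k)%:E else 0)).
  apply: eq_integral => y _; rewrite /slice /sector_pow /norm2/=.
  by case: (_ < 1)%R.
case: ifPn => [x01|x01]; last first.
  by apply: integral0_eq => y _; rewrite slice_out.
have ms : measurable [set y : mR | slice x y].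
  apply: measurable_setb; apply: measurable_and.
    by apply: measurable_fun_ltr => //; apply: measurable_funD => //;
      exact: measurable_funX.
  apply: measurable_and; [apply: measurable_fun_ltr|apply: measurable_fun_ler] => //=;
    exact: measurable_funM.
rewrite -integral_if integral_cst//.
by rewrite EFinM -lebesgue_measure_slice.
Qed.

Lemma sector_integralE : sector_integral n k =
  \int[mu]_(t in `[0%R, a]) (2 * (t ^+ k * sin t ^+ 2))%:E +
  \int[mu]_(t in `[a, (pi / 2)%R]) (2 * tan a * (t ^+ k * (sin t * cos t)))%:E.
Proof.
pose G1 (x : R) := (acosc x ^+ k * (2 * Num.sqrt (1 - x ^+ 2)))%R.
pose G2 (x : R) := (acosc x ^+ k * (2 * x * tan a))%R.
have cacos x y : (-1 <= x)%R -> (y <= 1)%R ->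
    {within `[x, y], continuous (fun x : R => acosc x ^+ k)%R}.
  move=> x1 y1; have : {within `[(-1)%R, 1%R], continuous (fun x : R =>
    acosc x ^+ k)%R}.
    move=> z; exact: (continuous_comp (@continuous_acosc R z) (@exprn_continuous
      _ _ _)).
  by apply: continuous_subspaceW; apply: subset_itvScc; rewrite bnd_simp.
have cG1 x y : (-1 <= x)%R -> (y <= 1)%R -> {within `[x, y], continuous G1}.
  move=> x1 y1; apply: withinM; first exact: cacos.
  apply: continuous_subspaceT => z; apply: cvgM; first exact: cvg_cst.
  apply: (@continuous_comp R R R (fun x : R => (1 - x ^+ 2)%R) (@Num.sqrt R)).
    by apply: cvgB; [exact: cvg_cst|exact: exprn_continuous].
  exact: sqrt_continuous.
have cG2 x y : (-1 <= x)%R -> (y <= 1)%R -> {within `[x, y], continuous G2}.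
  move=> x1 y1; apply: withinM; first exact: cacos.
  apply: continuous_subspaceT => z; apply: cvgM; last exact: cvg_cst.
  by apply: cvgM; [exact: cvg_cst|exact: cvg_id].
have mG (G : R -> R) (I : interval R) : [set` I] `<=` `[0%R, 1%R] ->
    {within `[0%R, 1%R], continuous G} -> measurable_fun [set` I] (EFin \o G).
  move=> I1 cG; apply/measurable_EFinP; apply: subspace_continuous_measurable_fun => //.
  exact: continuous_subspaceW cG.
have c1 : (cos a <= 1)%R := cos_le1 _.
have sin0pi t : (0 <= t <= pi / 2)%R -> (0 <= sin t)%R.
  by move=> t01; rewrite sin_ge0_pi//; have := pi_gt0 R; lra.
have -> : \int[mu]_(t in `[0%R, a]) (2 * (t ^+ k * sin t ^+ 2))%:E =
    \int[mu]_(x in `[cos a, 1%R]) (G1 x)%:E.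
  transitivity (\int[mu]_(x in `[cos a, cos 0%R]) (G1 x)%:E); last by rewrite cos0.
  rewrite integral_cos_substitution//; [|exact: ltW|by have := pi_gt0 R;
    have := a_le; lra|].
    apply: eq_integral => t; rewrite inE/= in_itv/= => /andP[t0 ta]; congr (_%:E).
    rewrite /G1 acosc_cos ger0_norm//; last by have := pi_gt0 R; have := a_le; lra.
    rewrite -sin2cos2 sqrtr_sqr ger0_norm; first by ring.
    by apply: sin0pi; rewrite t0 (le_trans ta).
  by apply: cG1; rewrite ?cos0// (le_trans _ cos_a)//; lra.
have -> : \int[mu]_(t in `[a, (pi / 2)%R]) (2 * tan a * (t ^+ k * (sin t * cos t)))%:E =
    \int[mu]_(x in `[0%R, cos a]) (G2 x)%:E.
  transitivity (\int[mu]_(x in `[cos (pi / 2), cos a]) (G2 x)%:E);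
    last by rewrite cos_pihalf.
  rewrite integral_cos_substitution//; [|exact: ltW|by have := pi_gt0 R; lra|].
    apply: eq_integral => t; rewrite inE/= in_itv/= => /andP[ta tpi]; congr (_%:E).
    rewrite /G2 acosc_cos ger0_norm//; first by ring.
    - by have := a_gt0; lra.
    - by have := pi_gt0 R; have := a_gt0; lra.
    by have := a_gt0; lra.
  by apply: cG2; rewrite ?cos_pihalf//; lra.
rewrite sector_integral_slices.
transitivity (\int[mu]_(x in `]0%R, 1%R[) ((if cos a <= x then G1 x else G2 x)%R%:E)).
  rewrite (_ : `]0%R, 1%R[%classic = [set x : mR | (0 < x < 1)%R]); last first.
    by apply/seteqP; split => x /=; rewrite in_itv.
  rewrite integral_if; apply: eq_integral => x _; case: ifP => // _.
  by congr (_%:E); case: ifP.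
have G0 x : (0 <= x <= 1)%R -> (0 <= if (cos a <= x)%R then G1 x else G2 x)%R.
  move=> /andP[x0 x1]; case: ifPn => [_|cx].
    by rewrite !mulr_ge0// ?exprn_ge0 ?acosc_ge0// sqrtr_ge0.
  have ta0 : (0 <= tan a)%R by rewrite divr_ge0// ltW.
  apply: mulr_ge0; first exact: exprn_ge0 (acosc_ge0 x).
  by apply: mulr_ge0 => //; exact: mulr_ge0.
(* For n = 2 the part bounded by the rays has width 0, so the value given to tan (pi / 2) is
   irrelevant. *)
have [c0|c0] := eqVneq (cos a) 0%R.
  rewrite c0 set_itv1 integral_set1 adde0 [RHS]integral_itv_bndoo; last first.
    by apply: mG; [apply: subset_itv_oo_cc|apply: cG1; lra].
  apply: eq_integral => x; rewrite inE/= in_itv/= => /andP[x0 _].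
  by rewrite ltW.
have cp : (0 < cos a)%R by rewrite lt_neqAle eq_sym c0.
have ca1 : (cos a < 1)%R.
  have cs := cos2Dsin2 a; rewrite ltNge; apply/negP => ca1.
  by have : (0 < sin a ^+ 2)%R; [exact: exprn_gt0|nra].
have mp (I : interval R) : [set` I] `<=` `[0%R, 1%R] ->
    measurable_fun ([set` I] : set mR) (fun x =>
      (if cos a <= x then G1 x else G2 x)%R%:E).
  move=> I1; apply/measurable_EFinP.
  have mI : measurable ([set` I] : set mR) by exact: measurable_itv.
  apply: (@measurable_fun_if _ _ mR mR G1 G2 [set` I] mI (fun x => cos a <= x)%R).
  - by apply: measurable_fun_ler.
  - apply: (measurable_funS mI (@subIsetl _ _ _)).
    by apply/measurable_EFinP; apply: mG => //; apply: cG1; lra.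
  - apply: (measurable_funS mI (@subIsetl _ _ _)).
    by apply/measurable_EFinP; apply: mG => //; apply: cG2; lra.
(* The pieces are half-open at cos a so that the test [cos a <= x] is constant on each. *)
have E : `]0%R, 1%R[%classic =
    (`]0%R, cos a[%classic `|` `[cos a, 1%R[%classic :> set mR).
  apply/seteqP; split => x /=; rewrite !in_itv/=.
    by move=> /andP[-> ->]; have [_|_] := ltP x (cos a); [left|right].
  by move=> [/andP[-> xc]|/andP[cx ->]]; rewrite ?(lt_trans xc)// (lt_le_trans cp).
rewrite E ge0_integral_setU//; last 3 first.
- by rewrite -E; apply: mp; exact: subset_itv_oo_cc.
- move=> x; rewrite -E/= in_itv/= => /andP[x0 x1].
  by rewrite lee_fin G0// !ltW.
- apply/disj_setPS => x [] /=; rewrite !in_itv/= => /andP[_ x1] /andP[x2 _].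
  by move: x1; rewrite ltNge x2.
rewrite addeC; congr (_ + _).
  rewrite -integral_itv_bndo_bndc; last first.
    by apply: mG; [move=> x /=; rewrite !in_itv/= => /andP[x1 x2]; apply/andP;
      split; lra|apply: cG1; lra].
  by apply: eq_integral => x; rewrite inE/= in_itv/= => /andP[-> _].
rewrite [RHS]integral_itv_bndoo; last first.
  by apply: mG; [move=> x /=; rewrite !in_itv/= => /andP[x1 x2]; apply/andP;
    split; lra|apply: cG2; lra].
by apply: eq_integral => x; rewrite inE/= in_itv/= => /andP[_];
  rewrite ltNge => /negbTE ->.
Qed.

End sector_slices.

(** * The hypergeometric series *)

Section integrals.
Context {R : realType}.
Local Notation mu := (@lebesgue_measure R).
Implicit Types (f F g G : R -> R) (a b x : R) (m N k : nat).

Definition rint f a b : R := \int[mu]_(t in `[a, b]) f t.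

Lemma integrable_segment f a b : continuous f -> mu.-integrable `[a, b] (EFin \o f).
Proof.
move=> cf; apply: continuous_compact_integrable; first exact: segment_compact.
exact: continuous_subspaceT.
Qed.

Lemma rintE f a b : continuous f ->
  (\int[mu]_(t in `[a, b]) (f t)%:E)%E = (rint f a b)%:E.
Proof.
move=> cf; rewrite /rint /Rintegral fineK//.
by apply: integrable_fin_num => //; exact: integrable_segment.
Qed.

Lemma rintZ r f a b : continuous f -> rint (fun t => r * f t) a b = r * rint f a b.
Proof. by move=> cf; rewrite /rint RintegralZl//; exact: integrable_segment. Qed.

Lemma rintN f a b : continuous f -> rint (fun t => - f t) a b = - rint f a b.
Proof.
by move=> cf; rewrite -[RHS]mulN1r -rintZ//; apply: eq_Rintegral => t _; rewrite mulN1r.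
Qed.

Lemma rintD f g a b : continuous f -> continuous g ->
  rint (fun t => f t + g t) a b = rint f a b + rint g a b.
Proof. by move=> cf cg; rewrite /rint RintegralD//; exact: integrable_segment. Qed.

Lemma rintB f g a b : continuous f -> continuous g ->
  rint (fun t => f t - g t) a b = rint f a b - rint g a b.
Proof. by move=> cf cg; rewrite /rint RintegralB//; exact: integrable_segment. Qed.

Lemma eq_rint f g a b : f =1 g -> rint f a b = rint g a b.
Proof. by move=> fg; apply: eq_Rintegral => t _; exact: fg. Qed.

Lemma rint_split f a b : continuous f -> 0 < a -> a <= b ->
  rint f 0 b = rint f 0 a + rint f a b.
Proof.
move=> cf a0 ab; apply/eqP; rewrite addrC -subr_eq; apply/eqP.
rewrite /rint Rintegral_itvB ?bnd_simp//; [|exact: integrable_segment|exact: ltW].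
rewrite Rintegral_itv_obnd_cbnd//.
by apply: integrableS (integrable_segment a b cf) => //; exact: subset_itv_oc_cc.
Qed.

Lemma derivable_LRcontinuous F f a b : (forall x, is_derive x 1 F (f x)) ->
  derivable_oo_LRcontinuous F a b.
Proof.
move=> dF; have cF : continuous F.
  by move=> x; apply: differentiable_continuous; apply/derivable1_diffP;
    exact: ex_derive.
split; first by move=> x _; exact: ex_derive.
- by apply: cvg_at_right_filter; exact: cF.
- by apply: cvg_at_left_filter; exact: cF.
Qed.

Lemma rint_FTC F f a b : a < b -> continuous f -> (forall x, is_derive x 1 F (f x)) ->
  rint f a b = F b - F a.
Proof.
move=> ab cf dF; apply: EFin_inj;
  rewrite -rintE// (continuous_FTC2 ab _ (derivable_LRcontinuous _ _ dF))//.
  exact: continuous_subspaceT.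
by move=> x _; rewrite derive1E derive_val.
Qed.

Lemma rint_by_parts F G f g a b : a < b -> continuous f -> continuous g ->
  (forall x, is_derive x 1 F (f x)) -> (forall x, is_derive x 1 G (g x)) ->
  rint (fun t => F t * g t) a b =
  F b * G b - F a * G a - rint (fun t => f t * G t) a b.
Proof.
move=> ab cf cg dF dG; rewrite /rint.
rewrite (@Rintegration_by_parts _ F G f g)//;
  try (by apply: continuous_subspaceT); try exact: derivable_LRcontinuous.
- by move=> x _; rewrite derive1E derive_val.
- by move=> x _; rewrite derive1E derive_val.
Qed.

Lemma continuousMr f g : continuous f -> continuous g -> continuous (fun t =>
  f t * g t).
Proof. by move=> cf cg x; apply: cvgM; [exact: cf|exact: cg]. Qed.

Lemma continuous_pow m : continuous (fun t : R => t ^+ m).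
Proof. exact: exprn_continuous. Qed.

Lemma continuous_sin_affine c d : continuous (fun t : R => sin (c + d * t)).
Proof.
move=> x; apply: (@continuous_comp _ _ _ (fun t : R => c + d * t) (@sin R));
  last exact: continuous_sin.
by apply: cvgD; [exact: cvg_cst|apply: cvgM; [exact: cvg_cst|exact: cvg_id]].
Qed.

Lemma continuous_cos_affine c d : continuous (fun t : R => cos (c + d * t)).
Proof.
move=> x; apply: (@continuous_comp _ _ _ (fun t : R => c + d * t) (@cos R));
  last exact: continuous_cos.
by apply: cvgD; [exact: cvg_cst|apply: cvgM; [exact: cvg_cst|exact: cvg_id]].
Qed.

Lemma is_derive_monomial m x :
  is_derive x 1 (fun t : R => t ^+ m.+1 / m.+1%:R) (x ^+ m).
Proof.
have d : is_derive x 1 ((id : R -> R) ^+ m.+1) _ := is_deriveX m.+1 (is_derive_id x 1).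
have -> : (fun t : R => t ^+ m.+1 / m.+1%:R) = m.+1%:R^-1 *: ((id : R -> R) ^+ m.+1).
  by apply/funext => t; rewrite /GRing.scale/= fctE mulrC.
apply: is_derive_eq.
by rewrite /GRing.scale/= mulr1 mulKf// pnatr_eq0.
Qed.

Lemma is_derive_sin_affine (c d x : R) :
  is_derive x 1 (fun t : R => sin (c + d * t)) (d * cos (c + d * x)).
Proof.
by apply: is_derive_eq; rewrite add0r mul1r /GRing.scale/= mulr1 mulrC.
Qed.

Lemma is_derive_cos_affine (c d x : R) :
  is_derive x 1 (fun t : R => cos (c + d * t)) (- (d * sin (c + d * x))).
Proof.
by apply: is_derive_eq; rewrite add0r mul1r /GRing.scale/= mulr1 mulNr mulrC.
Qed.

(* The argument is 2 * (a - t), in the shape of [continuous_sin_affine]. *)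
Definition sin_moment m a := rint (fun t => t ^+ m * sin (2 * a + (-2) * t)) 0 a.
Definition cos_moment m a := rint (fun t => t ^+ m * cos (2 * a + (-2) * t)) 0 a.

(** By parts, integrating the power: the boundary term vanishes at 0 through the power and at a
    through the sine. This is why the argument is 2 (a - t); in [cos_momentE] only the term at a
    survives. *)
Lemma sin_momentE m a : 0 < a ->
  sin_moment m a = 2 / m.+1%:R * cos_moment m.+1 a.
Proof.
move=> a0.
have cs := @continuous_cos_affine (2 * a) (-2).
rewrite /sin_moment (eq_rint _ _ (fun t => mulrC _ _)).
have cf : continuous (fun t : R => -2 * cos (2 * a + -2 * t)).
  by apply: continuousMr => //; exact: cst_continuous.
rewrite (rint_by_parts a0 cf (@continuous_pow m) (is_derive_sin_affine (2 * a) (-2))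
  (is_derive_monomial m)).
rewrite mulNr subrr sin0 mul0r expr0n/= mul0r mulr0 subrr sub0r.
rewrite /cos_moment -rintZ; last exact: continuousMr (@continuous_pow _) cs.
rewrite -rintN; last first.
  apply: continuousMr; first exact: cf.
  by apply: continuousMr; [exact: continuous_pow|exact: cst_continuous].
by apply: eq_rint => t; ring.
Qed.

Lemma cos_momentE m a : 0 < a ->
  cos_moment m a = a ^+ m.+1 / m.+1%:R - 2 / m.+1%:R * sin_moment m.+1 a.
Proof.
move=> a0.
have ss := @continuous_sin_affine (2 * a) (-2).
rewrite /cos_moment (eq_rint _ _ (fun t => mulrC _ _)).
have cf : continuous (fun t : R => - (-2 * sin (2 * a + -2 * t))).
  by move=> x; apply: cvgN; exact: (continuousMr (@cst_continuous _ _ _) ss).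
rewrite (rint_by_parts a0 cf (@continuous_pow m) (is_derive_cos_affine (2 * a) (-2))
  (is_derive_monomial m)).
rewrite mulNr subrr cos0 mul1r expr0n/= mul0r mulr0 subr0; congr (_ - _).
rewrite /sin_moment -rintZ; last exact: continuousMr (@continuous_pow _) ss.
by apply: eq_rint => t; ring.
Qed.

Lemma sin_moment_rec m a : 0 < a ->
  sin_moment m a = 2 * a ^+ m.+2 / (m.+1%:R * m.+2%:R) -
                   4 / (m.+1%:R * m.+2%:R) * sin_moment m.+2 a.
Proof.
move=> a0; rewrite sin_momentE// cos_momentE//.
have p0 : m.+1%:R != 0 :> R by rewrite pnatr_eq0.
have q0 : m.+2%:R != 0 :> R by rewrite pnatr_eq0.
by move: m.+1%:R m.+2%:R p0 q0 => p q p0 q0; field; rewrite p0 q0.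
Qed.

Lemma sin_moment_bound m a : 0 < a -> `|sin_moment m a| <= a ^+ m.+1.
Proof.
move=> a0; have cf : continuous (fun t : R => t ^+ m * sin (2 * a + -2 * t)).
  by apply: continuousMr; [exact: continuous_pow|exact: continuous_sin_affine].
apply: (le_trans (le_normr_Rintegral _ (integrable_segment 0 a cf))) => //.
apply: (@le_trans _ _ (rint (fun t => t ^+ m) 0 a)).
  apply: le_Rintegral => //.
  - apply: integrable_segment => x; apply: cvg_norm; exact: cf.
  - exact: integrable_segment (@continuous_pow _).
  move=> t; rewrite /= in_itv/= => /andP[t0 _].
  rewrite normrM ger0_norm ?exprn_ge0// ler_piMr ?exprn_ge0//.
  by rewrite ler_norml sin_geN1 sin_le1.
rewrite (rint_FTC a0 (@continuous_pow _) (is_derive_monomial m)).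
rewrite expr0n mul0r subr0 ler_pdivrMr ?ltr0n// ler_peMr ?ler1n ?exprn_ge0 ?(ltW a0)//.
Qed.

End integrals.

Section hypergeometric.
Context {R : realType}.
Implicit Types (a b x : R) (m N j k : nat).

Lemma pochhammerS b j : pochhammer b j.+1 = pochhammer b j * (b + j%:R).
Proof. by rewrite /pochhammer big_ord_recr. Qed.

Lemma pochhammer1 j : pochhammer (1 : R) j = j`!%:R.
Proof.
elim: j => [|j IH]; first by rewrite /pochhammer big_ord0.
by rewrite pochhammerS IH factS natrM nat1r mulrC.
Qed.

Lemma fact_le_pochhammer b j : 1 <= b -> j`!%:R <= pochhammer b j.
Proof.
move=> b1; rewrite -pochhammer1; apply: ler_prod => i _.
by rewrite addr_ge0//= lerD2r.
Qed.

Definition poch2 m j : R := pochhammer ((m + 3)%:R / 2) j * pochhammer ((m +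
  4)%:R / 2) j.

(** The two parameters differ by 1 / 2, so up to powers of 2 their Pochhammer products interleave
    into one product of consecutive integers, the one that [sin_moment_rec] produces. *)
Lemma poch2S m j :
  poch2 m j.+1 = poch2 m j * ((m + 2 * j.+1).+1%:R * (m + 2 * j.+1).+2%:R / 4).
Proof.
rewrite /poch2 !pochhammerS mulrACA; congr (_ * _).
by rewrite mulnS !(natrD, natrM, =^~natr1); field.
Qed.

Lemma fact_le_poch2 m j : j`!%:R <= poch2 m j.
Proof.
have h p : (2 <= p)%N -> j`!%:R <= pochhammer (p%:R / 2 : R) j.
  by move=> p2; apply: fact_le_pochhammer; rewrite ler_pdivlMr// mul1r ler_nat.
have f1 : 1 <= j`!%:R :> R by rewrite ler1n fact_gt0.
have h3 := h (m + 3)%N (leq_trans (isT : (2 <= 3)%N) (leq_addl _ _)).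
have h4 := h (m + 4)%N (leq_trans (isT : (2 <= 4)%N) (leq_addl _ _)).
by rewrite /poch2 -[leLHS]mulr1 ler_pM//; exact: le_trans h4.
Qed.

Lemma poch2_gt0 m j : 0 < poch2 m j.
Proof. by apply: lt_le_trans (fact_le_poch2 m j); rewrite ltr0n fact_gt0. Qed.

(** This is [sin_moment_rec] unrolled N times; the 4 of each step is absorbed by [poch2S]. *)
Lemma sin_moment_partial m a N : 0 < a ->
  sin_moment m a = 2 * a ^+ m.+2 / (m.+1%:R * m.+2%:R) *
      (\sum_(j < N) (- (a ^+ 2)) ^+ j / poch2 m j) +
    (-1) ^+ N * ((m + 2 * N).+1%:R * (m + 2 * N).+2%:R) /
      (m.+1%:R * m.+2%:R * poch2 m N) * sin_moment (m + 2 * N) a.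
Proof.
move=> a0; elim: N => [|N IH].
  rewrite big_ord0 mulr0 add0r muln0 addn0 /poch2 /pochhammer !big_ord0 !mulr1.
  by rewrite mul1r divff ?mul1r// mulf_neq0// pnatr_eq0.
rewrite {1}IH big_ord_recr/= (sin_moment_rec _ a0) poch2S.
have -> : (m + 2 * N.+1)%N = (m + 2 * N).+2 by rewrite mulnS addnCA.
have -> : a ^+ (m + 2 * N).+2 = a ^+ m.+2 * (a ^+ 2) ^+ N.
  by rewrite -exprM -exprD addSn addSn.
have -> : (- (a ^+ 2)) ^+ N = (-1) ^+ N * (a ^+ 2) ^+ N by exact: exprNn.
rewrite [(-1) ^+ N.+1]exprS.
have := poch2_gt0 m N; move: (poch2 m N) => P /gt_eqF/negbT P0.
have nz p : p.+1%:R != 0 :> R by rewrite pnatr_eq0.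
move: (nz m) (nz m.+1) (nz (m + 2 * N)%N) (nz (m + 2 * N).+1) (nz (m + 2 * N).+2)
  (nz (m + 2 * N).+3).
move: (m.+1%:R) (m.+2%:R) ((m + 2 * N).+1%:R) ((m + 2 * N).+2%:R)
  ((m + 2 * N).+3%:R) ((m + 2 * N).+4%:R) => p1 q1 p q p' q' hp1 hq1 hp hq hp' hq'.
move: (\sum_(j < N) _) (sin_moment _ a) (a ^+ m.+2) ((a ^+ 2) ^+ N) ((-1) ^+ N)
  => S U A B s.
by field; rewrite P0 hp1 hq1 hp hq hp' hq'.
Qed.

Lemma sin_moment_hypergeometric m a : 0 < a ->
  2 * a ^+ m.+2 / (m.+1%:R * m.+2%:R) *
  hypergeometric_1F2 1 ((m + 3)%:R / 2) ((m + 4)%:R / 2) (- (a ^+ 2)) =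
  sin_moment m a.
Proof.
move=> a0; set K := 2 * a ^+ m.+2 / _.
have K0 : K != 0.
  by rewrite gt_eqF// divr_gt0// mulr_gt0// ?exprn_gt0// ltr0n.
pose r N := (-1) ^+ N * ((m + 2 * N).+1%:R * (m + 2 * N).+2%:R) /
  (m.+1%:R * m.+2%:R * poch2 m N) * sin_moment (m + 2 * N) a.
(* Each ratio (p + 2 N + 1) / (p + 1) is at most 1 + 2 N <= 3 ^ N, and there are two of them, hence
   the 9. With [poch2 m N >= N!] and [sin_moment_bound], a term of the exponential series of 9 a^2
   dominates. *)
have rbound N : `|r N| <= a ^+ m.+1 * exp_coeff (9 * a ^+ 2) N.
  have P0 := poch2_gt0 m N.
  have ratio p : (p + 2 * N).+1%:R / p.+1%:R <= 3 ^+ N :> R.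
    rewrite ler_pdivrMr ?ltr0n// -natrX -natrM ler_nat.
    have h : (1 + 2 * N <= 3 ^ N)%N.
      by elim: N {P0} => // N IHN; rewrite expnS; lia.
    by apply: (@leq_trans ((1 + 2 * N) * p.+1)); [lia|rewrite leq_mul2r h orbT].
  have D0 : 0 < m.+1%:R * m.+2%:R * poch2 m N.
    by apply: mulr_gt0 => //; apply: mulr_gt0; rewrite ltr0n.
  rewrite /r !normrM normfV normrX normrN1 expr1n mul1r (gtr0_norm D0).
  rewrite !(ger0_norm (ler0n _ _)).
  rewrite (_ : _ / _ = ((m + 2 * N).+1%:R / m.+1%:R) * ((m.+1 + 2 * N).+1%:R /
    m.+2%:R) / poch2 m N); last first.
    have nz p : p.+1%:R != 0 :> R by rewrite pnatr_eq0.
    rewrite addSn; move: (poch2 m N) (lt0r_neq0 P0) (nz m) (nz m.+1).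
    move: m.+1%:R m.+2%:R (m + 2 * N).+1%:R (m + 2 * N).+2%:R => p q u v P hP hp hq.
    by field; rewrite hP hp hq.
  have bU : `|sin_moment (m + 2 * N) a| <= a ^+ m.+1 * (a ^+ 2) ^+ N.
    by rewrite -exprM -exprD addSn; exact: sin_moment_bound.
  have b9 : (m + 2 * N).+1%:R / m.+1%:R * ((m.+1 + 2 * N).+1%:R / m.+2%:R) <= 9
    ^+ N :> R.
    rewrite (_ : 9 = 3 * 3 :> R); last by rewrite -natrM.
    by rewrite exprMn ler_pM// divr_ge0.
  have bP : (poch2 m N)^-1 <= (N`!%:R)^-1.
    by rewrite lef_pV2 ?posrE ?ltr0n ?fact_gt0//; exact: fact_le_poch2.
  apply: le_trans (ler_pM _ _ (ler_pM _ _ b9 bP) bU) _ => //.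
  - by rewrite !mulr_ge0// ?invr_ge0// ltW.
  - by rewrite invr_ge0 ltW.
  rewrite exp_coeffE [(9 * _) ^+ N]exprMn le_eqVlt; apply/orP; left; apply/eqP.
  by move: (N`!%:R^-1) (a ^+ m.+1) ((a ^+ 2) ^+ N) (9 ^+ N) => x y z t; ring.
have r0 : r @ \oo --> 0.
  have e0 : (fun N => a ^+ m.+1 * exp_coeff (9 * a ^+ 2) N) @ \oo --> 0.
    by rewrite -(mulr0 (a ^+ m.+1)); apply: cvgM; [exact: cvg_cst|exact: cvg_exp_coeff].
  have en : (fun N => - (a ^+ m.+1 * exp_coeff (9 * a ^+ 2) N)) @ \oo --> 0.
    by rewrite -oppr0; exact: cvgN.
  apply: (squeeze_cvgr _ en e0).
  by apply: nearW => N; rewrite -ler_norml.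
suff cS : series (fun j => pochhammer 1 j /
    (pochhammer ((m + 3)%:R / 2) j * pochhammer ((m + 4)%:R / 2) j) *
    ((- (a ^+ 2)) ^+ j / j`!%:R)) @ \oo --> sin_moment m a / K.
  by rewrite /hypergeometric_1F2 (cvg_lim _ cS)// mulrC divfK.
rewrite (_ : series _ = fun N => (sin_moment m a - r N) / K); last first.
  apply/funext => N; rewrite {1}(sin_moment_partial m N a0) -/K -/(r N) addrK.
  rewrite [RHS]mulrC mulKf// /series/= big_mkord; apply: eq_bigr => j _.
  rewrite pochhammer1 -/(poch2 m j).
  have f0 : j`!%:R != 0 :> R by rewrite pnatr_eq0 -lt0n fact_gt0.
  move: (poch2 m j) (lt0r_neq0 (poch2_gt0 m j)) (j`!%:R) f0 ((- a ^+ 2) ^+ j).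
  by move=> P hP F hF z; field; rewrite hP hF.
rewrite -[X in _ --> X / K]subr0; apply: cvgM; last exact: cvg_cst.
by apply: cvgB => //; exact: cvg_cst.
Qed.

(* [0 + 2 * t] is 2 * t in the shape of [continuous_cos_affine]. *)
Definition cos_primitive k x : R := rint (fun t => t ^+ k * cos (0 + 2 * t)) 0 x.
Definition sin_primitive k x : R := rint (fun t => t ^+ k * sin (0 + 2 * t)) 0 x.

Lemma continuous_pow_cos k : continuous (fun t : R => t ^+ k * cos (0 + 2 * t)).
Proof.
by apply: continuousMr; [exact: continuous_pow|exact: continuous_cos_affine].
Qed.

Lemma continuous_pow_sin k : continuous (fun t : R => t ^+ k * sin (0 + 2 * t)).
Proof.
by apply: continuousMr; [exact: continuous_pow|exact: continuous_sin_affine].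
Qed.

Lemma sin_moment_primitives k a : sin_moment k a =
  sin (2 * a) * cos_primitive k a - cos (2 * a) * sin_primitive k a.
Proof.
have cc := @continuous_pow_cos k; have ss := @continuous_pow_sin k.
rewrite /cos_primitive /sin_primitive -!rintZ// -rintB; first last.
- by apply: continuousMr => //; exact: cst_continuous.
- by apply: continuousMr => //; exact: cst_continuous.
by apply: eq_rint => t; rewrite !add0r mulNr sinB; ring.
Qed.

Lemma cos_moment_primitives k a : cos_moment k a =
  cos (2 * a) * cos_primitive k a + sin (2 * a) * sin_primitive k a.
Proof.
have cc := @continuous_pow_cos k; have ss := @continuous_pow_sin k.
rewrite /cos_primitive /sin_primitive -!rintZ// -rintD; first last.
- by apply: continuousMr => //; exact: cst_continuous.
- by apply: continuousMr => //; exact: cst_continuous.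
by apply: eq_rint => t; rewrite !add0r mulNr cosB; ring.
Qed.

(* Times 1 / a, this is the moment when a = pi / n; for n = 2 the last summand is
   0, whatever the junk value of tan (pi / 2). *)
Definition moment_closed k a : R :=
  a ^+ k.+1 / k.+1%:R - cos_primitive k a +
  tan a * (sin_primitive k (pi / 2) - sin_primitive k a).

(** The three series are sine moments: of order k + 1 at a, and of order k at pi / 2 and at a.
    Integration by parts lowers the first to a cosine moment of order k, and the addition formulas
    turn all of them into the primitives of t^k cos 2t and t^k sin 2t. *)
Lemma lens_moment_formulaE k x : 0 < x -> cos (pi / x) != 0 ->
  lens_moment_formula k x = (pi / x)^-1 * moment_closed k (pi / x).
Proof.
move=> x0 ca; rewrite /lens_moment_formula.
have ppi := pi_gt0 R; set a := pi / x in ca *.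
have a0 : 0 < a by rewrite divr_gt0.
have p20 : 0 < pi / 2 :> R by rewrite divr_gt0.
have E1 := sin_moment_hypergeometric k.+1 a0.
have E2 := sin_moment_hypergeometric k p20.
have E3 := sin_moment_hypergeometric k a0.
have -> : pi ^+ 2 / x ^+ 2 = a ^+ 2 by rewrite expr_div_n.
have -> : pi ^+ 2 / 4 = (pi / 2) ^+ 2 :> R by rewrite expr_div_n -natrX.
have -> : x = pi / a by rewrite /a invf_div mulrCA divff ?mulr1// gt_eqF.
rewrite addSn -addnS addSn -addnS in E1.
move: E1 E2 E3.
set H1 := hypergeometric_1F2 _ ((k + 4)%:R / 2) _ _.
set H2 := hypergeometric_1F2 _ _ _ (- (pi / 2) ^+ 2).
set H3 := hypergeometric_1F2 _ ((k + 3)%:R / 2) _ _.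
move=> E1 E2 E3.
have U2 : sin_moment k (pi / 2) = sin_primitive k (pi / 2).
  rewrite sin_moment_primitives (_ : 2 * (pi / 2) = pi :> R); last by field.
  by rewrite sinpi cospi mul0r sub0r mulN1r opprK.
have V := cos_momentE k a0; have U3 := sin_moment_primitives k a.
rewrite cos_moment_primitives in V.
rewrite U2 in E2; rewrite U3 in E3.
transitivity (a^-1 * (2 / k.+1%:R * sin_moment k.+1 a + tan a *
    (sin_primitive k (pi / 2) -
     (sin (2 * a) * cos_primitive k a - cos (2 * a) * sin_primitive k a)))).
  rewrite -E1 -E2 -E3 !addn1 !addn2 !addn3 natrM !exprSr.
  have nz p : p.+1%:R != 0 :> R by rewrite pnatr_eq0.
  move: (nz k) (nz k.+1) (nz k.+2); move: k.+1%:R k.+2%:R k.+3%:R => p q r p0 q0 r0.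
  move: (a ^+ k) ((pi / 2) ^+ k) (tan a) => A B t.
  by field; rewrite p0 q0 r0 gt_eqF.
have -> : 2 / k.+1%:R * sin_moment k.+1 a = a ^+ k.+1 / k.+1%:R -
    (cos (2 * a) * cos_primitive k a + sin (2 * a) * sin_primitive k a).
  by rewrite V subKr.
rewrite /moment_closed; congr (_ * _).
have c2 : cos (2 * a) = 2 * cos a ^+ 2 - 1 by rewrite mulr_natl cos_mulr2n mulr_natl.
have s2 : sin (2 * a) = 2 * (sin a * cos a).
  by rewrite mulr_natl mulr2n sinD; ring.
have sE : sin a = tan a * cos a by rewrite divfK.
(* The coefficients of [cos_primitive k a] and [sin_primitive k a] collapse by these two identities,
   which need cos a != 0. *)
have e1 : cos (2 * a) + tan a * sin (2 * a) = 1.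
  have cs := cos2Dsin2 a; rewrite c2 s2 {1}sE.
  have -> : 2 * cos a ^+ 2 - 1 + tan a * (2 * (tan a * cos a * cos a)) =
    2 * (cos a ^+ 2 + (tan a * cos a) ^+ 2) - 1 by ring.
  by rewrite -sE cs; ring.
have e2 : sin (2 * a) - tan a * cos (2 * a) = tan a.
  by rewrite c2 s2 sE; ring.
move: (cos (2 * a)) (sin (2 * a)) e1 e2 => c s e1 e2.
move: (a ^+ k.+1 / _) (cos_primitive k a) (sin_primitive k a) (sin_primitive k
  (pi / 2)) => T C S S2.
have -> : T - (c * C + s * S) + tan a * (S2 - (s * C - c * S)) =
  T - (c + tan a * s) * C + (tan a * S2 - (s - tan a * c) * S) by ring.
by rewrite e1 e2 mul1r -mulrBr.
Qed.

Lemma cvg_dnbhs (g : R -> R) x y : g @ x --> y ->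
  (forall z, z != x -> g z != y) -> g @ x^' --> y^'.
Proof.
move=> c inj A hA.
have hA' : nbhs y [set u | u != y -> A u] := hA.
suff h : nbhs x [set z | z != x -> A (g z)] by exact: h.
have hc : nbhs x (g @^-1` [set u | u != y -> A u]) := c _ hA'.
by apply: filterS hc => z /= h zx; exact: h (inj z zx).
Qed.

Lemma cvg_slope (f : R -> R) x l : is_derive x 1 f l ->
  (f y - f x) / (y - x) @[y --> x^'] --> l.
Proof.
move=> df; have := @ex_derive _ _ _ _ _ _ _ df; rewrite /derivable.
have := @derive_val _ _ _ _ _ _ _ df; rewrite /derive => dl cv.
have {cv}dl : h^-1 *: (f (h *: 1 + x) - f x) @[h --> 0^'] --> l by rewrite -dl.
have sh : (fun y => y - x) @ x^' --> (0 : R)^'.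
  apply: cvg_dnbhs; last by move=> y; rewrite subr_eq0.
  by rewrite -(subrr x); apply: cvgB; [exact: cvg_id|exact: cvg_cst].
have := cvg_comp _ _ sh dl; apply: cvg_trans.
rewrite (_ : _ \o _ = fun y => (f y - f x) / (y - x))//.
by apply/funext => y /=; rewrite /GRing.scale/= mulr1 subrK mulrC.
Qed.

Lemma is_derive_primitive (f : R -> R) (x : R) : continuous f -> 0 < x ->
  is_derive x 1 (rint f 0) (f x).
Proof.
move=> cf x0.
have [d e] := @continuous_FTC1_closed R f 0 x (x + 1) (ltr_pwDr ltr01 (lexx x))
  (integrable_segment _ _ cf) x0 (cf x).
by apply: DeriveDef; [exact: d|rewrite -derive1E e].
Qed.

(** The tangent has a simple pole at pi / 2, while the difference of sine primitives vanishes there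
    to higher order, its derivative being (pi / 2)^k sin pi = 0. *)
Lemma moment_closed_cvg k :
  a^-1 * moment_closed k a @[a --> (pi / 2 : R)^'] -->
  (pi / 2)^-1 * ((pi / 2) ^+ k.+1 / k.+1%:R - cos_primitive k (pi / 2)).
Proof.
have p20 : 0 < pi / 2 :> R by rewrite divr_gt0// pi_gt0.
have dC := is_derive_primitive (@continuous_pow_cos k) p20.
have cC : cos_primitive k a @[a --> (pi / 2 : R)^'] --> cos_primitive k (pi / 2).
  apply: cvg_within_filter; apply: differentiable_continuous.
  by apply/derivable1_diffP; exact: ex_derive.
have dS : is_derive (pi / 2 : R) 1 (sin_primitive k) 0.
  have := is_derive_primitive (@continuous_pow_sin k) p20.
  by rewrite add0r (_ : 2 * (pi / 2) = pi :> R) ?sinpi ?mulr0//; field.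
have sS := cvg_slope dS.
have dcos : is_derive (pi / 2 : R) 1 cos (-1).
  by have := is_derive_cos (pi / 2 : R); rewrite sin_pihalf.
have sc := cvg_slope dcos.
have sinC : sin a @[a --> (pi / 2 : R)^'] --> (1 : R).
  have := @continuous_sin R (pi / 2); rewrite /continuous_at sin_pihalf.
  exact: cvg_within_filter.
have idC : a @[a --> (pi / 2 : R)^'] --> (pi / 2 : R).
  by apply: cvg_within_filter; exact: cvg_id.
have quot : tan a * (sin_primitive k (pi / 2) - sin_primitive k a) @[a --> (pi /
  2 : R)^'] --> (0 : R).
  (* The product is rewritten with the slopes of the sine primitive and of cos at pi / 2, which tend
     to 0 and -1. *)
  have q : - sin a * ((sin_primitive k a - sin_primitive k (pi / 2)) / (a - pi / 2) *
      ((cos a - cos (pi / 2)) / (a - pi / 2))^-1) @[a --> (pi / 2 : R)^'] -->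
      (- 1 * (0 * (-1)^-1) : R).
    apply: cvgM; first exact: cvgN sinC.
    by apply: cvgM => //; apply: cvgV => //; rewrite oppr_eq0 oner_eq0.
  rewrite mul0r mulr0 in q; apply: cvg_trans q.
  apply: near_eq_cvg; near=> a.
  have na : a - pi / 2 != 0 by rewrite subr_eq0; near: a; exact: nbhs_dnbhs_neq.
  rewrite /= /tan cos_pihalf subr0 invf_div.
  move: (sin_primitive _ _) (sin_primitive _ _) (sin a) (cos a)^-1 (a - pi / 2)
    na => S1 S2 s c d d0.
  by field.
apply: cvgM; first by apply: cvgV => //; rewrite gt_eqF.
rewrite -[X in _ --> X]addr0; apply: cvgD => //; apply: cvgB => //.
apply: cvgM; last exact: cvg_cst.
by apply: cvg_within_filter; exact: exprn_continuous.
Unshelve. all: by end_near. Qed.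

Lemma lens_moment_formula_cvg2 k :
  lens_moment_formula k x @[x --> (2 : R)^'] -->
  (pi / 2)^-1 * ((pi / 2) ^+ k.+1 / k.+1%:R - cos_primitive k (pi / 2)).
Proof.
have ppi := pi_gt0 R.
have sh : (fun x : R => pi / x) @ (2 : R)^' --> (pi / 2 : R)^'.
  apply: cvg_dnbhs; first by apply: cvgM; [exact: cvg_cst|apply: cvgV;
    [|exact: cvg_id]].
  by move=> y; apply: contra_neq => /(mulfI (lt0r_neq0 ppi)) /invr_inj.
have := cvg_comp _ _ sh (@moment_closed_cvg k); apply: cvg_trans.
apply: near_eq_cvg; near=> x.
have x2 : x != 2 by near: x; exact: nbhs_dnbhs_neq.
(* This keeps pi / x in ]0, pi[, where cos vanishes only at pi / 2, that is, for x = 2. *)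
have x1 : 1 < x by near: x; apply: nbhs_dnbhs; apply: lt_nbhsr; rewrite ltr1n.
have x0 : 0 < x by apply: lt_trans x1.
have px : 0 < pi / x by rewrite divr_gt0.
have pxpi : pi / x < pi by rewrite ltr_pdivrMr// ltr_pMr.
rewrite /= lens_moment_formulaE//; apply/eqP => cx0.
have : cos (pi / x) = cos (pi / 2) by rewrite cx0 cos_pihalf.
have p2 : pi / 2 < pi :> R by rewrite ltr_pdivrMr// ltr_pMr// ltr1n.
move=> /cos_inj; rewrite !in_itv/= !ltW// ?divr_gt0//=.
move=> /(_ isT isT) /(mulfI (lt0r_neq0 ppi)) /invr_inj /eqP.
by rewrite (negbTE x2).
Unshelve. all: by end_near. Qed.

End hypergeometric.

Lemma cos_double (R : realType) (t : R) : cos (0 + 2 * t) = 1 - 2 * sin t ^+ 2.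
Proof.
by rewrite add0r mulr_natl cos_mulr2n cos2sin2; move: (sin t ^+ 2) => s; ring.
Qed.

Lemma sin_double (R : realType) (t : R) : sin (0 + 2 * t) = 2 * (sin t * cos t).
Proof.
by rewrite add0r mulr_natl mulr2n sinD; move: (sin t) (cos t) => s c; ring.
Qed.

(** * The value of the moment for n >= 2 *)

Section lens_moment_value.
Context {R : realType} (n : nat) (n2 : (2 <= n)%N).
Local Notation mu := (@lebesgue_measure R).
Local Notation a := (pi / n%:R : R).

Let n0 : 0 < n%:R :> R. Proof. by rewrite ltr0n (leq_trans _ n2). Qed.

Let a_gt0 : 0 < a. Proof. by rewrite divr_gt0// pi_gt0. Qed.

Let a_le : a <= pi / 2.
Proof. by rewrite ler_pM2l ?pi_gt0// lef_pV2 ?posrE// ler_nat. Qed.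

Lemma sector_integral_closed k : sector_integral n k = (moment_closed k a)%:E.
Proof.
have cc := @continuous_pow_cos R k; have ss := @continuous_pow_sin R k.
have ck := @continuous_pow R k.
rewrite (sector_integralE n2).
have cB : continuous (fun t : R => t ^+ k - t ^+ k * cos (0 + 2 * t)).
  by move=> x; apply: cvgB; [exact: ck|exact: cc].
have cT : continuous (fun t : R => tan a * (t ^+ k * sin (0 + 2 * t))).
  by apply: continuousMr => //; exact: cst_continuous.
transitivity (rint (fun t => t ^+ k - t ^+ k * cos (0 + 2 * t)) 0 a +
    rint (fun t => tan a * (t ^+ k * sin (0 + 2 * t))) a (pi / 2))%:E.
  rewrite EFinD -!rintE//; congr (_ + _)%E; apply: eq_integral => t _; congr (_%:E).
    rewrite cos_double; move: (sin (t : R) ^+ 2) ((t : R) ^+ k) => s u; ring.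
  by rewrite sin_double; ring.
congr (_%:E); rewrite rintB// rintZ// /moment_closed.
rewrite (rint_FTC a_gt0 ck (is_derive_monomial k)) expr0n mul0r subr0.
congr (_ + _ * _).
by rewrite /sin_primitive (rint_split ss a_gt0 a_le) addrAC subrr add0r.
Qed.

Lemma moment_closed0 : moment_closed 0 a = a.
Proof.
have p20 : 0 < pi / 2 :> R by rewrite divr_gt0// pi_gt0.
have dF (t : R) : is_derive t 1 (fun t : R => 2^-1 * sin (0 + 2 * t))
    (t ^+ 0 * cos (0 + 2 * t)).
  have d := is_derive_sin_affine 0 2 t.
  by apply: is_derive_eq; rewrite /GRing.scale/= expr0 mul1r mulKf.
have dG (t : R) : is_derive t 1 (fun t : R => - 2^-1 * cos (0 + 2 * t))
    (t ^+ 0 * sin (0 + 2 * t)).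
  have d := is_derive_cos_affine 0 2 t.
  by apply: is_derive_eq; rewrite /GRing.scale/= expr0 mul1r mulrNN mulKf.
have c0 (x : R) : 0 < x -> cos_primitive 0 x = sin x * cos x.
  move=> x0; rewrite /cos_primitive (rint_FTC x0 (@continuous_pow_cos R 0) dF).
  by rewrite sin_double mulr0 addr0 sin0 mulr0 subr0 mulKf.
have s0 (x : R) : 0 < x -> sin_primitive 0 x = sin x ^+ 2.
  move=> x0; rewrite /sin_primitive (rint_FTC x0 (@continuous_pow_sin R 0) dG).
  rewrite !cos_double sin0 expr0n/=.
  by move: (sin x ^+ 2) => s; field.
rewrite /moment_closed -[a ^+ 1]/a divr1 c0// !s0// sin_pihalf expr1n -cos2sin2.
have [ca|ca] := eqVneq (cos a) 0; first by rewrite ca expr0n/= !mulr0 subr0 addr0.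
by rewrite expr2 mulrA divfK// addrNK.
Qed.

Lemma lens_moment0 : lens_moment R n 0 = 1%E.
Proof.
rewrite /lens_moment unlock; under eq_integral do rewrite expr0.
by rewrite integral_cst// mul1e; exact: probability_setT.
Qed.

Lemma lens_moment_closed k : lens_moment R n k = (a^-1 * moment_closed k a)%:E.
Proof.
have E j : lens_moment R n j = (n%:R / fine (@disk_area R) * moment_closed j a)%:E.
  by rewrite (lens_momentE n2) sector_integral_closed EFinM.
(* For k = 0 this reads n / [disk_area] * a = 1: the disk area is pi, and the prefactor is 1 / a. *)
have := E 0%N; rewrite lens_moment0 moment_closed0 => -[] h.
rewrite E; congr ((_ * _)%:E); apply: (mulIf (lt0r_neq0 a_gt0)).
by rewrite -h mulVf// gt_eqF.
Qed.

End lens_moment_value.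

Theorem theorem1 (R : realType) (k : nat) :
  (forall n : nat, (3 <= n)%N ->
     lens_moment R n k = (lens_moment_formula k (n%:R : R))%:E) /\
  (exists2 l : R,
     lens_moment_formula k x @[x --> (2 : R)^'] --> l &
     lens_moment R 2 k = l%:E).
Proof.
split.
  move=> n n3; rewrite lens_moment_closed ?(ltnW n3)// lens_moment_formulaE//.
    by rewrite ltr0n (ltn_trans _ n3).
  have ppi := pi_gt0 R; have n0 : 0 < n%:R :> R by rewrite ltr0n (ltn_trans _ n3).
  rewrite gt_eqF// cos_gt0_pihalf//; apply/andP; split.
    by rewrite (@lt_trans _ _ 0) ?oppr_lt0 ?divr_gt0.
  by rewrite ltr_pM2l// ltf_pV2 ?posrE// ltr_nat.
eexists; first exact: lens_moment_formula_cvg2.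
rewrite lens_moment_closed//; congr (_%:E); congr (_ * _).
by rewrite /moment_closed subrr mulr0 addr0.
Qed.
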